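(* 1. Let $\nu_0, \nu_1$ be complex numbers with $\nu_0 \neq 0$, and let $$u_{n+2} = \nu_1 u_{n+1} + \nu_0 u_n$$ be a binary linear recurrence sequence of complex numbers. Suppose that at least one of the roots $\alpha_1, \alpha_2$ of the polynomial $z^2 - \nu_1 z - \nu_0$ is not a root of unity, and, if $\alpha_1 \neq \alpha_2$, assume moreover that $\alpha_1/\alpha_2$ is not a root of unity. Then $\{u_n\}$ has multiplicity $$U \leqslant 2^{57}.$$ 2. Let $\mu_0, \mu_1, \mu_2$ be complex numbers with $\mu_0 \neq 0$, and consider a ternary sequence $$v_{m+3} = \mu_2 v_{m+2} + \mu_1 v_{m+1} + \mu_0 v_m$$ with $|v_0| + |v_1| + |v_2| \neq 0$. If the polynomial $z^3 - \mu_2 z^2 - \mu_1 z - \mu_0$ has three distinct roots $\alpha_1, \alpha_2, \alpha_3$, assume that at least one of the quotients $\alpha_1/\alpha_3$, $\alpha_2/\alpha_3$ is not a root of unity. Then $\{v_n\}$ has zero-multiplicity $$U(0) \leqslant 2^{57}.$$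
   Context: The sequences are indexed by the integers. For a complex number $c$, the $c$-multiplicity $U(c)$ of a sequence $\{u_n\}$ is the number of solutions $m \in \mathbb{Z}$ of the equation $u_m = c$; $U(0)$ is the zero-multiplicity. The multiplicity of the sequence is $U = \sup_c U(c)$, the supremum being over complex numbers $c$.
   Formalization: Binary and ternary sequences are taken to have order exactly 2 and 3 (no shorter linear recurrence holds); otherwise the claim fails, e.g. u_n = 1 with roots 1, 2, or v_n = 1 + (-1)^n with roots 1, 2, -1. *)

(* Defs.v *)
From HB Require Import structures.
From mathcomp Require Import all_boot all_order all_algebra.
From mathcomp Require Import complex.
From mathcomp Require Import boolp classical_sets cardinality reals ereal measure.

Set Implicit Arguments.
Unset Strict Implicit.
Unset Printing Implicit Defensive.

Import Order.TTheory GRing.Theory Num.Theory.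

Local Open Scope classical_set_scope.
Local Open Scope ring_scope.

Definition is_root_of_unity (F : fieldType) (z : F) : Prop :=
  exists2 n : nat, (0 < n)%N & n.-unity_root z.

Definition satisfies_recurrence (F : fieldType) (k : nat) (a : 'I_k -> F)
    (u : int -> F) : Prop :=
  forall n : int, u (n + k%:Z) = \sum_(i < k) a i * u (n + i%:Z).

(* A "binary" (resp. "ternary") sequence is one of order exactly 2 (resp. 3):
   it satisfies a recurrence of that length and no shorter one.  For k = 0 the
   recurrence reads u = 0, so a sequence of positive order is nonzero. *)
Definition has_order (F : fieldType) (k : nat) (u : int -> F) : Prop :=
  (exists a : 'I_k -> F, satisfies_recurrence a u) /\
  (forall (j : nat) (a : 'I_j -> F), (j < k)%N -> ~ satisfies_recurrence a u).

(* [counting] takes the value +oo on infinite sets. *)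
Definition multiplicity_at (R : realType) (u : int -> R[i]) (c : R[i]) :
    \bar R :=
  counting [set m : int | u m = c].

Definition zero_multiplicity (R : realType) (u : int -> R[i]) : \bar R :=
  multiplicity_at u 0.

Definition multiplicity (R : realType) (u : int -> R[i]) : \bar R :=
  ereal_sup [set multiplicity_at u c | c in [set: R[i]]].

(* Main.v *)
Require Import Defs.
From HB Require Import structures.
From mathcomp Require Import all_boot all_order all_algebra all_field.
From mathcomp Require Import complex ring lra zify.
From mathcomp Require Import boolp classical_sets cardinality reals ereal measure sequences.
From mathcomp Require Import exp topology normedtype derive realfun.

Set Implicit Arguments.
Unset Strict Implicit.
Unset Printing Implicit Defensive.

Import Order.TTheory GRing.Theory Num.Theory numFieldNormedType.Exports.

Local Open Scope ring_scope.

(** Shifting out the roots of the characteristic polynomial one at a time writes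
the sequence as an explicit exponential polynomial, and its multiplicity becomes
the number of integers m solving one of three kinds of equations.

Repeated roots lead to (a + b m) g ^ m = c with b != 0, or to a polynomial of
degree at most 2 times a power.  The first has at most 3 solutions
([linear_exponential]): the square of the absolute value of both sides equates a
quadratic in m with K e ^ (l m), and by Rolle such curves meet at most 3 times.

Distinct roots lead to a be ^ m + b ga ^ m = 1 with be and ga not both roots of
unity.  Here the bound must be uniform over all fields, and the proof follows the
method of Beukers and Schlickewei for x + y = 1 in finitely generated groups:
heights, hypergeometric Pade approximants, and lower bounds for small points.

- The field.  Finitely many solutions, together with the fact that they are
  distinct, survive a suitable ring morphism from the ring that the parameters
  generate to the algebraic numbers ([specializes_fg]), so the parameters may be
  taken in a Galois number field L, embedded in R[i] in #|I| ways
  ([numfield_embeddings]).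

- Heights.  No valuation is extended to L.  The finite part of the height of a
  point (x : y : z) is read off from products over all embeddings sg i of one
  coordinate each: a real r bounds the coordinates at the finite places when all
  these products become algebraic integers after multiplication by e ^ (- r).
  Archimedean bounds b together with r form a box around the coordinates; the
  height is the infimum of the sizes of the boxes.  Liouville's inequality (a set
  with a nonzero element only fits in boxes of nonnegative size) is the fact that
  a nonzero rational algebraic integer is at least 1 in absolute value.

- Gaps.  Let x_m = (a be ^ m : b ga ^ m : -1), a point on the line with equation
  x + y + z = 0, and let eta be the height of (be : ga : 1).  Two solutions m < m'
  give two vectors orthogonal to x_m, namely (1 : 1 : 1) and x_m' / x_m, whose
  cross product is x_m; hence h (x_m) <= (m' - m) eta + ln 2 ([hgt_gap]).

- Pade.  With 2 n-th powers instead, a Pade approximant W of degree n of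
  (1 - X) ^ (2 n) gives a vector orthogonal to x_m ^ (2 n), and so does
  x_m' / x_m ^ (2 n).  The cross product gives
  n h (x_m) <= h (x_m' / x_m ^ (2 n)) + O(n), uniformly in n ([hgt_pade]).  For
  m' >= 2 n m the right-hand side is at most (m' - 2 n m) eta + n (4 h (x_0) + O(1)),
  so a large solution m excludes every solution m' >= 6 m.

- Small points.  Raising to the 7th power is additive modulo 7.  So a vanishing
  determinant of points stays divisible by 7 when the points are raised to the
  7th power; as 7 exceeds the number 6 of terms of the determinant, this bounds
  the heights from below unless the new determinant is zero, and among 8 points
  on a line some determinant is nonzero ([hgt_small_points]).

Starting from a solution of minimal height, the small points show that the index
times eta grows to 6 after boundedly many solutions, the gaps then make it grow
geometrically, and the Pade inequality ends the list: fewer than 4150 solutions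
follow the starting one on each side ([gap_principle_bound]).  Altogether at most
8300 integers, far below 2 ^ 57, solve the equation ([unit_equation_int]). *)

(** * Absolute values on R[i] and algebraic integers *)

Section AbsoluteValue.
Variable R : realType.
Implicit Types z w : R[i].

Definition cabs z : R := complex.Re `|z|.

Lemma cabsE z : (cabs z)%:C%C = `|z|.
Proof. by rewrite /cabs RRe_real // normr_real. Qed.

Lemma cabs_ge0 z : 0 <= cabs z.
Proof. by rewrite -(ler0c (cabs z)) cabsE normr_ge0. Qed.

Lemma cabsM z w : cabs (z * w) = cabs z * cabs w.
Proof. by apply: (@complexI R); rewrite rmorphM /= !cabsE normrM. Qed.

Lemma cabsD z w : cabs (z + w) <= cabs z + cabs w.
Proof. by rewrite -lecR rmorphD /= !cabsE ler_normD. Qed.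

Lemma cabsN z : cabs (- z) = cabs z.
Proof. by rewrite /cabs normrN. Qed.

Lemma cabs_gt0 z : (0 < cabs z) = (z != 0).
Proof. by rewrite -ltcR cabsE normr_gt0. Qed.

Lemma cabs_real (x : R) : cabs x%:C%C = `|x|.
Proof. by apply: (@complexI R); rewrite cabsE normc_def /= expr0n addr0 sqrtr_sqr. Qed.

Lemma cabs1 : cabs 1 = 1.
Proof. by rewrite /cabs normr1. Qed.

Lemma cabs_int (m : int) : cabs m%:~R = `|m|%:~R.
Proof.
by rewrite -[m%:~R](rmorph_int (real_complex R)) cabs_real /= -intr_norm.
Qed.

Lemma cabsX z n : cabs (z ^+ n) = cabs z ^+ n.
Proof. by elim: n => [|n IH]; rewrite ?cabs1 // !exprS cabsM IH. Qed.

Lemma cabs_prod (J : Type) (r : seq J) (P : pred J) (F : J -> R[i]) :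
  cabs (\prod_(j <- r | P j) F j) = \prod_(j <- r | P j) cabs (F j).
Proof. by apply: (big_morph cabs cabsM cabs1). Qed.

Lemma cabs_sum (J : Type) (r : seq J) (P : pred J) (F : J -> R[i]) :
  cabs (\sum_(j <- r | P j) F j) <= \sum_(j <- r | P j) cabs (F j).
Proof.
elim/big_rec2: _ => [|j x y _ le]; first by rewrite /cabs normr0.
by apply: le_trans (cabsD _ _) _; rewrite lerD2l.
Qed.

End AbsoluteValue.

Section AlgebraicIntegers.
Variable C : numClosedFieldType.

Definition alg_int (z : C) := integralOver (intr : int -> C) z.

Lemma alg_int_prod (J : Type) (r : seq J) (P : pred J) (F : J -> C) :
  (forall j, P j -> alg_int (F j)) -> alg_int (\prod_(j <- r | P j) F j).
Proof.
move=> H; elim/big_ind: _ => //; first exact: integral1.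
by move=> x y; apply: integral_mul.
Qed.

Lemma alg_intX z n : alg_int z -> alg_int (z ^+ n).
Proof.
by move=> H; elim: n => [|n IH]; [apply: integral1|rewrite exprS; apply: integral_mul].
Qed.

Lemma alg_int_root z n : (0 < n)%N -> alg_int (z ^+ n) -> alg_int z.
Proof.
move=> n0 [p pmon pr]; exists (p \Po 'X^n).
  have sz1 : (1 < size ('X^n : {poly int}))%N by rewrite size_polyXn ltnS.
  have := lead_coef_comp p sz1.
  by rewrite lead_coefXn expr1n mulr1 (monicP pmon) => /eqP.
by move: pr; rewrite /root map_comp_poly map_polyXn horner_comp hornerXn.
Qed.

(** The algebraic numbers already know that a rational algebraic integer is an
integer, so the monic equation of q is read there. *)
Lemma alg_int_rat (q : rat) :
  alg_int (ratr q) -> exists m : int, q = m%:~R.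
Proof.
have ratI (F : numFieldType) (p : {poly int}) :
    map_poly (ratr : rat -> F) (map_poly intr p) = map_poly intr p.
  by rewrite -map_poly_comp; apply: eq_map_poly => x /=; apply: ratr_int.
case=> p pmon; rewrite /root -ratI => pr.
have {pr} pq : root (map_poly (intr : int -> rat) p) q.
  by rewrite -(fmorph_root (@ratr C)) /root.
have : (ratr q : algC) \in Num.int.
  apply: Cint_rat_Aint; first by apply: Crat_rat.
  apply: (@root_monic_Aint (map_poly intr p)).
  - by rewrite -ratI fmorph_root.
  - by apply: monic_map.
  - by apply/polyOverP => i; rewrite coef_map /= intr_int.
case/intrP => m; rewrite -(ratr_int algC) => /fmorph_inj ->.
by exists m.
Qed.

Lemma alg_int_denom z : algebraicOver (ratr : rat -> C) z ->
  exists2 D, (0 < D)%N & alg_int (D%:R * z).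
Proof.
case=> p p0 pz; have [q [a a0 Ep]] := rat_poly_scale p.
have qz : (map_poly intr q : {poly C}).[z] = 0.
  move: pz; rewrite Ep linearZ /= rootZ ?fmorph_eq0 ?invr_eq0 ?intr_eq0 //.
  rewrite -map_poly_comp.
  by under eq_map_poly do rewrite /= ratr_int; move/rootP.
have q0 : q != 0 by apply: contra_neq p0 => q0; rewrite Ep q0 rmorph0 scaler0.
pose c := lead_coef q.
have sq : (1 < size q)%N.
  rewrite ltnNge; apply/negP => /size1_polyC Eq; move: qz q0.
  rewrite Eq map_polyC hornerC /= => /eqP; rewrite intr_eq0 => /eqP ->.
  by rewrite eqxx.
have sqE : size q = (size q).-2.+2 by case: (size q) sq => [|[]].
pose n := (size q).-2.+1.
have alg_cz : alg_int (c%:~R * z).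
(* With c the leading coefficient of q and n its degree, c ^ (n - 1) q(X / c)
     is monic and integral, and its terms below degree n form w. *)
  pose w := \poly_(j < n) (q`_j * c ^+ (n.-1 - j)).
  exists ('X^n + w).
    rewrite monicE lead_coefDl ?lead_coefXn // size_polyXn ltnS.
    exact: size_poly.
  rewrite /root rmorphD /= map_polyXn hornerD hornerXn.
  have -> : (map_poly intr w).[c%:~R * z] =
     \sum_(j < n) c%:~R ^+ n.-1 * ((q`_j)%:~R * z ^+ j) :> C.
    rewrite (@horner_coef_wide _ n) ?(leq_trans (size_poly _ _)) ?size_poly //.
    apply: eq_bigr => j _; rewrite coef_map coef_poly ltn_ord /= rmorphM rmorphXn /=.
    have -> : c%:~R ^+ n.-1 = c%:~R ^+ (n.-1 - j) * c%:~R ^+ j :> C.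
      by rewrite -exprD subnK // -ltnS.
    by rewrite exprMn; ring.
  rewrite -mulr_sumr; move: qz; rewrite horner_coef size_map_inj_poly ?rmorph0 //; last exact: intr_inj.
  rewrite sqE -/n big_ord_recr /= => qz.
  have -> : \sum_(j < n) (q`_j)%:~R * z ^+ j = - (c%:~R * z ^+ n) :> C.
    apply/eqP; rewrite -addr_eq0 -[X in _ == X]qz; apply/eqP; congr (_ + _).
      by apply: eq_bigr => j _; rewrite coef_map.
    by rewrite coef_map /= /c lead_coefE sqE.
  by rewrite mulrN exprMn mulrA -exprSr /n /= subrr.
exists `|c|%N; first by rewrite absz_gt0 lead_coef_eq0.
have -> : (`|c|%N%:R * z : C) = ((-1) ^+ (c < 0)%R)%:~R * (c%:~R * z).
  by rewrite mulrA -rmorphM /= {3}(intEsign c) signrMK.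
apply: integral_mul => //; exact: integral_id.
Qed.

End AlgebraicIntegers.

(** * Pade approximants of powers of 1 - X *)

Section Pade.

Lemma bin_le_exp2 n m : ('C(n, m) <= 2 ^ n)%N.
Proof.
elim: n m => [|n IH] [|m]; rewrite ?bin0 ?bin0n ?expn_gt0 //.
by rewrite binS expnS mul2n -addnn leq_add.
Qed.

(** The polynomial (z - p - 1) ... (z - p - r) / r! in z, which vanishes exactly at
p + 1, ..., p + r: multiplying the coefficients of (1 - X) ^ D by it opens a gap of
length r after degree p. *)
Definition pade_weight (p r z : nat) : int :=
  if (z <= p)%N then (-1) ^+ r * 'C(p + r - z, r)%:Z else 'C(z - p.+1, r)%:Z.

Lemma pade_weightS p r z :
  r.+1%:Z * pade_weight p r.+1 z = (z%:Z - (p + r.+1)%:Z) * pade_weight p r z.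
Proof.
rewrite /pade_weight; case: leqP => zp.
  have := mul_bin_diag (p + r.+1 - z) r.
  have -> : ((p + r.+1 - z).-1 = p + r - z)%N by lia.
  move=> /(congr1 Posz); rewrite !PoszM exprS => H.
  have -> : (z%:Z - (p + r.+1)%:Z) = - (p + r.+1 - z)%N%:Z by lia.
  by transitivity (- (-1) ^+ r * ((r.+1)%:Z * 'C(p + r.+1 - z, r.+1)%:Z)); [ring|rewrite -H; ring].
have := mul_bin_left (z - p.+1) r; move=> /(congr1 Posz); rewrite !PoszM => H.
rewrite H; have [rz|rz] := leqP r (z - p.+1); last by rewrite bin_small // !mulr0.
by congr (_ * _); lia.
Qed.

Lemma pade_weight_gap p r z : (p < z)%N -> (z < p + r.+1)%N -> pade_weight p r z = 0.
Proof.
by move=> pz zr; rewrite /pade_weight leqNgt pz /= bin_small // ltn_subLR //; lia.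
Qed.

Lemma pade_weight_le p r z D : (p + r < D)%N -> (z <= D)%N ->
  `|pade_weight p r z| <= (2 ^ D)%N%:Z.
Proof.
move=> prD zD; rewrite /pade_weight; case: leqP => zp.
  rewrite normrMsign; rewrite [`|_|]ger0_norm // lez_nat.
  by apply: leq_trans (bin_le_exp2 _ _) _; rewrite leq_exp2l //; lia.
rewrite ger0_norm // lez_nat.
by apply: leq_trans (bin_le_exp2 _ _) _; rewrite leq_exp2l //; lia.
Qed.

Definition pade_poly (D p r : nat) : {poly int} :=
  \poly_(z < D.+1) ((-1) ^+ z * 'C(D, z)%:Z * pade_weight p r z).

Lemma coef_pade_poly D p r z :
  (pade_poly D p r)`_z = (-1) ^+ z * 'C(D, z)%:Z * pade_weight p r z.
Proof.
rewrite coef_poly ltnS; case: leqP => // zD.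
by rewrite bin_small // mulr0 mul0r.
Qed.

Lemma pade_poly0 D p : pade_poly D p 0 = (1 - 'X) ^+ D.
Proof.
apply/polyP => z; rewrite coef_pade_poly /pade_weight expr0 mul1r !bin0 if_same mulr1.
have coef_sign (i : nat) (U : {poly int}) : ((-1) ^+ i * U)`_z = (-1) ^+ i * U`_z.
  by rewrite -!(signr_odd _ i); case: odd; rewrite ?expr0 ?expr1 ?mul1r ?mulN1r ?coefN.
rewrite exprBn coef_sum.
under eq_bigr do rewrite expr1n mulr1 coefMn coef_sign coefXn.
have [zD|zD] := ltnP z D.+1; last first.
  rewrite bin_small // mulr0 big1 // => i _.
  by rewrite gtn_eqF ?mulr0 ?mul0rn // (leq_trans _ zD).
rewrite (bigD1 (Ordinal zD)) //= big1 ?addr0; first by rewrite eqxx mulr1 -mulr_natr natz.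
move=> i iz; rewrite (_ : (z == i :> nat) = false) ?mulr0 ?mul0rn //.
by apply/negbTE; rewrite eq_sym.
Qed.

Let ratp (P : {poly int}) : {poly rat} := map_poly intr P.

(** The operator X d/dX - (p + r + 1) multiplies the coefficient of degree z by
z - (p + r + 1), the next factor of the weight. *)
Lemma pade_polyS D p r :
  'X * (pade_poly D p r)^`() - (p + r.+1)%:R%:P * pade_poly D p r
   = r.+1%:R%:P * pade_poly D p r.+1.
Proof.
apply/polyP => z; rewrite coefB !coefCM mulrC coefMX !coef_pade_poly.
have -> : (if z == 0%N then 0 else (pade_poly D p r)^`()`_z.-1) = z%:R * (pade_poly D p r)`_z.
  by case: z => [|z] /=; rewrite ?mul0r // coef_deriv mulr_natl.
rewrite coef_pade_poly; have := pade_weightS p r z; rewrite !natz => H.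
transitivity ((-1) ^+ z * 'C(D, z)%:Z * ((z%:Z - (p + r.+1)%:Z) * pade_weight p r z)).
  by ring.
by rewrite -H; ring.
Qed.

(** Each application of X d/dX - const lowers the order of vanishing at 1 by at most
one, and (1 - X) ^ D is the case r = 0. *)
Lemma pade_poly_dvd D p r : (r <= D)%N ->
  exists Q : {poly rat}, ratp (pade_poly D p r) = (1 - 'X) ^+ (D - r) * Q.
Proof.
elim: r => [|r IH] rD.
  exists 1; rewrite subn0 mulr1 pade_poly0 /ratp rmorphXn rmorphB /=.
  by rewrite rmorph1 map_polyX.
have [Q HQ] := IH (ltnW rD).
exists ((r.+1%:R^-1)%:P * (- (D - r)%:R%:P * ('X * Q)
  + (1 - 'X) * ('X * Q^`()) - (p + r.+1)%:R%:P * ((1 - 'X) * Q))).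
have E : ratp (r.+1%:R%:P * pade_poly D p r.+1) = r.+1%:R%:P * ratp (pade_poly D p r.+1).
  by rewrite /ratp rmorphM /= map_polyC /= rmorph_nat.
have r0 : r.+1%:R != 0 :> rat by rewrite pnatr_eq0.
have -> : ratp (pade_poly D p r.+1) = (r.+1%:R^-1)%:P * ratp (r.+1%:R%:P * pade_poly D p r.+1).
  by rewrite E mulrA -polyCM mulVf // mul1r.
rewrite mulrCA; congr (_ * _).
rewrite -pade_polyS /ratp rmorphB !rmorphM /= -deriv_map map_polyX map_polyC /= rmorph_nat.
rewrite -/(ratp _) HQ.
have -> : (D - r = (D - r.+1).+1)%N by lia.
set k := (D - r.+1)%N.
rewrite derivM deriv_exp derivB derivX (derivC 1) sub0r /= exprS.
rewrite -mulr_natr -polyC_natr; ring.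
Qed.

(** The coefficients of M / (1 - X) ^ (s + 1) majorize those of Q, which are integers.
Being stable under division by 1 - X, this keeps the quotient of a polynomial by a
high power of 1 - X exponentially bounded. *)
Definition int_bounded (M s : nat) (Q : {poly rat}) :=
  forall k, exists2 m : int, Q`_k = m%:~R & `|m| <= (M * 'C(k + s, s))%N%:Z.

(** Division by 1 - X takes partial sums of coefficients; on the majorants this is
Pascal's rule. *)
Lemma int_bounded_div M s Q :
  int_bounded M s ((1 - 'X) * Q) -> int_bounded M s.+1 Q.
Proof.
move=> H; elim=> [|k [m IHm IHle]].
  have [m Hm Hle] := H 0; exists m; last by move: Hle; rewrite !add0n !binn.
  by rewrite -Hm mulrBl mul1r coefB coefXM subr0.
have [m' Hm' Hle'] := H k.+1; exists (m + m').
  by rewrite rmorphD /= -IHm -Hm' mulrBl mul1r coefB coefXM /= addrC subrK.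
apply: le_trans (ler_normD _ _) _; apply: le_trans (lerD IHle Hle') _.
rewrite -PoszD lez_nat -mulnDr leq_mul2l; apply/orP; right.
by rewrite [X in (_ <= 'C(X, _))%N]addSn binS addSnnS.
Qed.

Lemma int_bounded_divX M s f Q :
  int_bounded M s ((1 - 'X) ^+ f * Q) -> int_bounded M (s + f) Q.
Proof.
elim: f s Q => [|f IH] s Q; first by rewrite expr0 mul1r addn0.
by rewrite exprS -mulrA addnS -addSn => /int_bounded_div /IH.
Qed.

Lemma ratp_inj : injective ratp.
Proof. by apply: map_inj_poly; [exact: intr_inj|]. Qed.

(** A collects the coefficients before the gap of the weighted binomial polynomial, B
those after it, and C is its quotient by the power of 1 - X which divides it. *)
Lemma pade_approximant p q r D f : D = (p + q + r).+1 -> f = (p + q).+1 -> exists A B C : {poly int},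
  [/\ [/\ (size A <= p.+1)%N, (size B <= q.+1)%N & (size C <= r.+1)%N],
   A + 'X^((p + r).+1) * B = (1 - 'X) ^+ f * C,
   [/\ (forall k, `|A`_k| <= (2 ^ (D + D))%N%:Z), (forall k, `|B`_k| <= (2 ^ (D + D))%N%:Z) &
    (forall k, (k <= r)%N -> `|C`_k| <= (2 ^ (3 * D))%N%:Z)]
  & A`_p != 0 /\ B`_q != 0].
Proof.
move=> ED Ef.
have rD : (r <= D)%N by lia.
have EDr : (D - r = f)%N by lia.
have [Q HQ] := pade_poly_dvd p rD; rewrite EDr in HQ.
set P := pade_poly D p r in HQ.
have Pz z : P`_z = (-1) ^+ z * 'C(D, z)%:Z * pade_weight p r z by rewrite coef_pade_poly.
have Pb z : `|P`_z| <= (2 ^ (D + D))%N%:Z.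
  have [zD|zD] := leqP z D; last by rewrite Pz bin_small // mulr0 mul0r.
  rewrite Pz -mulrA normrMsign normrM expnD PoszM; apply: ler_pM => //.
    by rewrite ger0_norm // lez_nat bin_le_exp2.
  by apply: pade_weight_le => //; lia.
have HB : int_bounded (2 ^ (D + D)) f Q.
  rewrite -[f]add0n; apply: int_bounded_divX; rewrite -HQ => k.
  by exists P`_k; rewrite ?coef_map // addn0 bin0 muln1.
pose C : {poly int} := \poly_(k < size Q) Num.floor Q`_k.
have HC : ratp C = Q.
  apply/polyP => k; rewrite coef_map coef_poly /=; case: ltnP => ks; last by rewrite nth_default.
  by have [m -> _] := HB k; rewrite intrKfloor.
exists (take_poly (p + r).+1 P), (drop_poly (p + r).+1 P), C.
have PC : P = (1 - 'X) ^+ f * C.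
  by apply: ratp_inj; rewrite /ratp rmorphM rmorphXn rmorphB /= rmorph1 map_polyX -/(ratp C) HC.
have sP : (size P <= D.+1)%N by apply: size_poly.
split.
- split.
  + apply/leq_sizeP => j pj; rewrite coef_take_poly; case: ltnP => // jr.
    by rewrite Pz pade_weight_gap ?mulr0 // addnS.
  + rewrite size_drop_poly; lia.
  + have [->|C0] := eqVneq C 0; first by rewrite size_poly0.
    have oX : (1 - 'X : {poly int}) != 0 by rewrite -opprB oppr_eq0 polyXsubC_eq0.
    have : size ((1 - 'X : {poly int}) ^+ f) = f.+1.
      by rewrite -opprB exprNn -signr_odd; case: odd; rewrite ?mulN1r ?mul1r ?size_polyN size_exp_XsubC.
    move=> sf; move: sP; rewrite PC size_mul ?expf_neq0 // sf.
    by move: (size C) => c; clear -ED Ef; lia.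
- by rewrite -PC mulrC poly_take_drop.
- split.
  + by move=> k; rewrite coef_take_poly; case: ltnP.
  + by move=> k; rewrite coef_drop_poly.
  + move=> k kr; have [m Hm Hle] := HB k.
    have -> : C`_k = m by apply: (@intr_inj rat); rewrite -Hm -HC coef_map.
    apply: le_trans Hle _; rewrite lez_nat (_ : 3 * D = (D + D) + D)%N; last lia.
    rewrite [in X in (_ <= X)%N]expnD leq_mul2l; apply/orP; right.
    by apply: leq_trans (bin_le_exp2 _ _) _; rewrite leq_exp2l //; lia.
- split.
  + rewrite coef_take_poly ltnS leq_addr Pz /pade_weight leqnn addKn binn mulr1.
    by rewrite !mulf_neq0 ?signr_eq0 // eqz_nat -lt0n bin_gt0; lia.
  + rewrite coef_drop_poly Pz /pade_weight ifF; last by apply/negbTE; lia.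
    by rewrite !mulf_neq0 ?signr_eq0 // eqz_nat -lt0n bin_gt0; lia.
Qed.

(** Two approximants of the same type, with degrees (n - 1, n, n) and (n, n - 1, n)
before padding.  Their determinant is divisible by (1 - X) ^ (2 n), because its
product with X ^ (2 n) is, and its degree is at most 2 n; so it is a constant multiple
of that power, and never vanishes away from 1.  Hence at every point at least one of
the two is not proportional to a given vector. *)
Lemma pade_pair n : (0 < n)%N ->
  exists A B C A' B' C' : {poly int},
    exists l : int,
  [/\ [/\ (size A <= n.+1)%N, (size B <= n.+1)%N & (size C <= n.+1)%N],
      [/\ (size A' <= n.+1)%N, (size B' <= n.+1)%N & (size C' <= n.+1)%N],
      A + 'X^(2 * n) * B = (1 - 'X) ^+ (2 * n) * C /\
        A' + 'X^(2 * n) * B' = (1 - 'X) ^+ (2 * n) * C',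
      (forall k, let M := (2 ^ (9 * n))%N%:Z in
        [/\ `|A`_k| <= M, `|B`_k| <= M & `|C`_k| <= M] /\
        [/\ `|A'`_k| <= M, `|B'`_k| <= M & `|C'`_k| <= M])
    & l != 0 /\ A * B' - A' * B = l%:P * (1 - 'X) ^+ (2 * n)].
Proof.
case: n => // m _; set n := m.+1.
have [||A [B [C [[sA sB sC] E [bA bB bC] [A0 B0]]]]] := @pade_approximant m n n (3 * n) (2 * n).
- by rewrite /n; lia.
- by rewrite /n; lia.
have [||A' [B' [C' [[sA' sB' sC'] E' [bA' bB' bC'] [A'0 B'0]]]]] := @pade_approximant n m n (3 * n) (2 * n).
- by rewrite /n; lia.
- by rewrite /n; lia.
have e1 : ((m + n).+1 = 2 * n)%N by rewrite /n; lia.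
have e2 : ((n + n).+1 = (2 * n).+1)%N by lia.
rewrite e1 in E; rewrite e2 exprSr -mulrA in E'.
have le9 e (t : int) : (e <= 9 * n)%N -> `|t| <= (2 ^ e)%N%:Z -> `|t| <= (2 ^ (9 * n))%N%:Z.
  by move=> en /le_trans; apply; rewrite lez_nat leq_exp2l.
have coefb (P : {poly int}) : (size P <= n.+1)%N ->
    (forall k, (k <= n)%N -> `|P`_k| <= (2 ^ (3 * (3 * n)))%N%:Z) -> forall k, `|P`_k| <= (2 ^ (9 * n))%N%:Z.
  move=> sP H k; have [kn|kn] := leqP k n; last by rewrite nth_default ?normr0 // (leq_trans sP).
  by apply: le9 (H k kn); lia.
have sXB' : (size ('X * B')%R <= n.+1)%N.
  by apply: leq_trans (size_polyMleq _ _) _; rewrite size_polyX /=.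
have szM (P Q : {poly int}) a b c : (size P <= a)%N -> (size Q <= b)%N ->
    ((a + b).-1 <= c)%N -> (size (P * Q)%R <= c)%N.
  move=> Pa Qb; apply: leq_trans; apply: leq_trans (size_polyMleq _ _) _.
  by rewrite -!subn1 leq_sub2r // leq_add.
pose Dt := A * ('X * B') - A' * B.
have sDt : (size Dt <= (2 * n).+1)%N.
  apply: leq_trans (size_polyD _ _) _; rewrite size_polyN geq_max; apply/andP; split.
    by apply: szM sA sXB' _; rewrite /n; lia.
  by apply: szM sA' sB _; rewrite /n; lia.
(* The leading terms of A' and B are the only contribution in degree 2 n. *)
have Dt2n : Dt`_(2 * n) != 0.
  rewrite coefB (_ : (A * ('X * B'))`_(2 * n) = 0); last first.
    by rewrite nth_default //; apply: szM sA sXB' _; rewrite /n; lia.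
  rewrite sub0r oppr_eq0 mul2n -addnn coefM.
  have nn : (n < (n + n).+1)%N by lia.
  rewrite (bigD1 (Ordinal nn)) //= addnK big1 ?addr0 ?mulf_neq0 //.
  move=> i ni; have [lt|le] := ltnP n i.
    by rewrite nth_default ?mul0r // (leq_trans sA').
  rewrite [B`_ _]nth_default ?mulr0 //; apply: leq_trans sB _.
  have : (i != n :> nat) by apply: contra ni => /eqP e; apply/eqP/val_inj.
  by move: le; lia.
have XDt : 'X^(2 * n) * Dt = (1 - 'X) ^+ (2 * n) * (A * C' - A' * C).
  rewrite mulrBr [RHS]mulrBr.
  rewrite (mulrCA ((1 - 'X) ^+ (2 * n)) A) -E' (mulrCA ((1 - 'X) ^+ (2 * n)) A') -E.
  by rewrite /Dt; ring.
exists A, B, C, A', ('X * B'), C', Dt`_0.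
split=> //.
- by split=> //; apply: leq_trans sA _.
- have b69 (t : int) : `|t| <= (2 ^ (3 * n + 3 * n))%N%:Z -> `|t| <= (2 ^ (9 * n))%N%:Z.
    by apply: le9; lia.
  move=> k /=; split; split.
  + exact: b69.
  + exact: b69.
  + exact: coefb.
  + exact: b69.
  + by rewrite coefXM; case: eqP => // _; apply: b69.
  + exact: coefb.
have [U HU] : exists U, ratp Dt = U * (1 - 'X) ^+ (2 * n).
  apply/dvdpP; rewrite -(@Gauss_dvdpr _ _ 'X^(2 * n)).
    have -> : 'X^(2 * n) * ratp Dt = ratp ('X^(2 * n) * Dt) by rewrite /ratp rmorphM /= map_polyXn.
    rewrite XDt /ratp rmorphM rmorphXn rmorphB /= rmorph1 map_polyX.
    exact: dvdp_mulr.
  apply: coprimep_expl; apply: coprimep_expr.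
  by rewrite coprimep_sym -opprB -scaleN1r coprimepZr ?oppr_eq0 ?oner_eq0 // coprimep_XsubC rootX oner_eq0.
have sX : size ((1 - 'X : {poly rat}) ^+ (2 * n)) = (2 * n).+1.
  by rewrite -opprB exprNn -signr_odd; case: odd; rewrite ?mulN1r ?mul1r ?size_polyN size_exp_XsubC.
have U1 : (size U <= 1)%N.
  have [->|U0] := eqVneq U 0; first by rewrite size_poly0.
  have : (size (ratp Dt) <= (2 * n).+1)%N := leq_trans (size_poly _ _) sDt.
  rewrite HU size_mul //; last by rewrite -size_poly_gt0 sX.
  by rewrite sX; move: (size U) => c; lia.
move/size1_polyC in U1.
have Dt0 : (Dt`_0)%:~R = U`_0.
  have -> : (Dt`_0)%:~R = (ratp Dt)`_0 by rewrite coef_map.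
  by rewrite HU U1 coefCM coefC /= -[X in _ * X]horner_coef0 horner_exp !hornerE ?subr0 ?expr1n ?mulr1.
have DtE : Dt = (Dt`_0)%:P * (1 - 'X) ^+ (2 * n).
  apply: ratp_inj; rewrite HU /ratp rmorphM rmorphXn rmorphB /= rmorph1 map_polyX map_polyC /=.
  by rewrite Dt0 -U1.
split=> //; apply: contra_neq Dt2n => e.
by rewrite DtE e mul0r coef0.
Qed.

End Pade.

(** * Heights on number fields *)

(** The field L enters only through finitely many embeddings sg i with algebraic values;
norms being rational is what makes the family of embeddings complete. *)
Section Heights.
Variables (R : realType) (L : fieldType) (I : finType).
Variable sg : I -> {rmorphism L -> R[i]}.
Hypothesis I_gt0 : (0 < #|I|)%N.
Hypothesis norm_rat : forall x, exists q : rat, \prod_i sg i x = ratr q.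
Hypothesis sg_alg : forall i x, algebraicOver (ratr : rat -> R[i]) (sg i x).

Implicit Types (X Y : L -> Prop) (b : I -> R) (r : R).

Definition arch_bounded X b := forall x, X x -> forall i, cabs (sg i x) <= expR (b i).

(** Over a number field this says that the product over the finite places v of the
maximum of |x|_v, x in X, is at most e ^ (- r), in a form that mentions no
valuation: choosing the element of X separately for each embedding is what replaces
the maximum at each place. *)
Definition fin_bounded X r := forall k : I -> L, (forall i, X (k i)) ->
  alg_int ((\prod_i sg i (k i)) * (expR (- r))%:C%C).

(** Some power of e ^ r is rational.  Rational e ^ r would suffice for Liouville's
inequality, but not for extracting roots in the equality for heights of powers. *)
Definition radical r :=
  exists2 N, (0 < N)%N & exists q : rat, expR (r * N%:R) = ratr q.

Definition boxed X b r := [/\ arch_bounded X b, fin_bounded X r & radical r].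

Definition box_size b r : R := (\sum_i b i - r) / #|I|%:R.

Lemma sg_eq0 i x : (sg i x == 0) = (x == 0).
Proof. exact: fmorph_eq0. Qed.

Lemma radicalD r s : radical r -> radical s -> radical (r + s).
Proof.
move=> [N N0 [q Hq]] [M M0 [q' Hq']]; exists (N * M)%N; first by rewrite muln_gt0 N0.
exists (q ^+ M * q' ^+ N).
rewrite (rmorphM (@ratr R)) /= !(rmorphXn (@ratr R)) /= -Hq -Hq' -!expRM_natr -expRD; congr expR.
by rewrite natrM; ring.
Qed.

Lemma radicalMn r n : radical r -> radical (n%:R * r).
Proof.
move=> [N N0 [q Hq]]; exists N => //; exists (q ^+ n).
by rewrite rmorphXn /= -Hq -expRM_natl; congr expR; ring.
Qed.

Lemma radical_div r n : (0 < n)%N -> radical r -> radical (r / n%:R).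
Proof.
move=> n0 [N N0 [q Hq]]; exists (n * N)%N; first by rewrite muln_gt0 n0.
by exists q; rewrite -Hq natrM; congr expR; field; rewrite pnatr_eq0 -lt0n.
Qed.

Lemma radical_ln (q : rat) : 0 < q -> radical (ln (ratr q : R)).
Proof.
by move=> q0; exists 1%N => //; exists q; rewrite mulr1 lnK // posrE ltr0q.
Qed.

Lemma radical0 : radical 0.
Proof. by exists 1%N => //; exists 1; rewrite mul0r expR0 rmorph1. Qed.

(** A suitable power of norm (u) * e ^ (- r) is a rational algebraic integer, nonzero,
hence at least 1 in absolute value; the archimedean bounds control the norm. *)
Lemma liouville X b r u : boxed X b r -> X u -> u != 0 -> 0 <= box_size b r.
Proof.
move=> [Ha Hf [N N0 [q' Hq']]] Xu u0.
have [q Hq] := norm_rat u.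
have q0 : q != 0.
  rewrite -(fmorph_eq0 (@ratr R[i])) /= -Hq.
  by apply/prodf_neq0 => i _; rewrite sg_eq0.
have := alg_intX N (Hf (fun=> u) (fun=> Xu)).
rewrite Hq exprMn -!rmorphXn /= -expRM_natr mulNr expRN Hq'.
have -> : ((ratr q')^-1)%:C%C = ratr q'^-1 :> R[i].
  by rewrite -fmorphV -[LHS]/(real_complex R (ratr q'^-1)) fmorph_rat.
rewrite -rmorphM /= => Hi; have [m Hm] := alg_int_rat Hi.
have q'0 : q' != 0.
  by rewrite -(fmorph_eq0 (@ratr R)) /= -Hq' gt_eqF // expR_gt0.
have m0 : m != 0.
  by rewrite -(intr_eq0 rat) -Hm mulf_neq0 // ?invr_eq0 // expf_neq0.
have le1 : 1 <= cabs (\prod_i sg i u) ^+ N * expR (- r * N%:R).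
  rewrite -cabsX Hq -rmorphXn /= -[expR _]ger0_norm ?expR_ge0 // -cabs_real -cabsM.
  rewrite mulNr expRN Hq' -[X in cabs (_ * X)]/(real_complex R (ratr q')^-1).
  rewrite -fmorphV fmorph_rat -rmorphM /= Hm ratr_int cabs_int.
  by rewrite -[1]/(1%:~R) ler_int -gtz0_ge1 normr_gt0.
rewrite expRM_natr -exprMn in le1.
have {}le1 : 1 <= cabs (\prod_i sg i u) * expR (- r).
  rewrite -(@ler_pXn2r _ N) ?nnegrE ?expr1n ?mulr_ge0 ?cabs_ge0 ?expR_ge0 //.
have : 1 <= expR (\sum_i b i - r).
  apply: le_trans le1 _; rewrite expRD ler_pM2r ?expR_gt0 // expR_sum cabs_prod.
  by apply: ler_prod => i _; rewrite cabs_ge0 Ha.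
rewrite -(expR0 R) ler_expR => H.
by rewrite divr_ge0.
Qed.

Definition mulset X Y z := exists x y, [/\ X x, Y y & z = x * y].

Lemma arch_mul X Y b b' : arch_bounded X b -> arch_bounded Y b' ->
  arch_bounded (mulset X Y) (fun i => b i + b' i).
Proof.
move=> HX HY _ [x [y [Xx Yy ->]]] i; rewrite rmorphM cabsM expRD.
by apply: ler_pM; rewrite ?cabs_ge0 // ?HX ?HY.
Qed.

Lemma fin_mul X Y r s : fin_bounded X r -> fin_bounded Y s ->
  fin_bounded (mulset X Y) (r + s).
Proof.
move=> HX HY k Hk.
have [kx Hkx] := choice Hk; have [ky Hky] := choice Hkx.
have -> : \prod_i sg i (k i) * (expR (- (r + s)))%:C%C =
  (\prod_i sg i (kx i) * (expR (- r))%:C%C) * (\prod_i sg i (ky i) * (expR (- s))%:C%C).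
  rewrite opprD expRD rmorphM /= mulrACA -big_split /=; congr (_ * _).
  by apply: eq_bigr => i _; case: (Hky i) => _ _ ->; rewrite rmorphM.
by apply: integral_mul; [apply: HX|apply: HY] => i; case: (Hky i).
Qed.

Inductive zspan X : L -> Prop :=
| zspan_in x : X x -> zspan X x
| zspan0 : zspan X 0
| zspanD x y : zspan X x -> zspan X y -> zspan X (x + y)
| zspanN x : zspan X x -> zspan X (- x).

Lemma zspan_sum X (J : Type) (s : seq J) (P : pred J) (F : J -> L) :
  (forall j, P j -> zspan X (F j)) -> zspan X (\sum_(j <- s | P j) F j).
Proof. by move=> H; elim/big_ind: _ => //; [apply: zspan0|apply: zspanD]. Qed.

Lemma zspanMn X x n : zspan X x -> zspan X (x *+ n).
Proof.
by move=> H; elim: n => [|n IH]; rewrite ?mulr0n ?mulrS; [apply: zspan0|apply: zspanD].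
Qed.

Lemma zspanMz X x (m : int) : zspan X x -> zspan X (m%:~R * x).
Proof.
move=> H; rewrite mulrzl; case: m => n; first by apply: zspanMn.
by rewrite NegzE mulrNz; apply: zspanN; apply: zspanMn.
Qed.

Lemma zspan_mul X Y x y : zspan X x -> zspan Y y -> zspan (mulset X Y) (x * y).
Proof.
move=> Hx; elim: Hx => {x} [x Xx| |x x' _ IH _ IH'|x _ IH] Hy.
- elim: Hy => {y} [y Yy| |y y' _ IH _ IH'|y _ IH].
  + by apply: zspan_in; exists x, y.
  + by rewrite mulr0; apply: zspan0.
  + by rewrite mulrDr; apply: zspanD.
  + by rewrite mulrN; apply: zspanN.
- by rewrite mul0r; apply: zspan0.
- by rewrite mulrDl; apply: zspanD; auto.
- by rewrite mulNr; apply: zspanN; auto.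
Qed.

(** Embedding by embedding, the chosen element is replaced by a combination of elements
of X: the product is additive in each choice. *)
Lemma fin_zspan X r : fin_bounded X r -> fin_bounded (zspan X) r.
Proof.
move=> HX k Hk.
suff H (s : seq I) : forall k : I -> L, (forall i, zspan X (k i)) ->
    (forall i, i \notin s -> X (k i)) ->
    alg_int (\prod_i sg i (k i) * (expR (- r))%:C%C).
  by apply: (H (enum I)) => // i; rewrite mem_enum.
elim: s => [|j s IH] {Hk}k Hk Hs; first by apply: HX => i; apply: Hs.
pose kj x i := if i == j then x else k i.
suff H x : zspan X x -> alg_int (\prod_i sg i (kj x i) * (expR (- r))%:C%C).
  have := H _ (Hk j); congr (alg_int (_ * _)); apply: eq_bigr => i _.
  by rewrite /kj; case: eqP => // ->.
pose M := (\prod_(i | i != j) sg i (k i)) * (expR (- r))%:C%C.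
have E y : \prod_i sg i (kj y i) * (expR (- r))%:C%C = sg j y * M.
  rewrite (bigD1 j) //= {1}/kj eqxx -mulrA; congr (_ * (_ * _)).
  by apply: eq_bigr => i /negPf ij; rewrite /kj ij.
rewrite E; elim => {x} [x Xx| |x y _ Hx _ Hy|x _ Hx].
- rewrite -E; apply: IH => i; rewrite /kj; case: eqP => ij.
  + exact: zspan_in.
  + exact: Hk.
  + by [].
  + by move=> Hi; apply: Hs; rewrite inE negb_or Hi andbT; apply/eqP.
- by rewrite rmorph0 mul0r; apply: integral0.
- by rewrite rmorphD mulrDl; apply: integral_add.
- by rewrite rmorphN mulNr; apply: integral_opp.
Qed.

Lemma fin_sub X Y r : (forall x, Y x -> X x) -> fin_bounded X r -> fin_bounded Y r.
Proof. by move=> YX HX k Hk; apply: HX => i; apply: YX. Qed.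

Lemma arch_sub X Y b : (forall x, Y x -> X x) -> arch_bounded X b -> arch_bounded Y b.
Proof. by move=> YX HX x /YX; apply: HX. Qed.

(** The coordinates of a point of the projective plane. *)
Definition tri (x y z : L) u := [\/ u = x, u = y | u = z].

Definition hgt x y z : R :=
  inf [set s | exists b r, boxed (tri x y z) b r /\ s = box_size b r].

Lemma tri_denom x y z : exists D : nat, [/\ (0 < D)%N &
  forall u, tri x y z u -> forall i, alg_int (D%:R * sg i u)].
Proof.
have den1 u : exists D : nat, (0 < D)%N /\ forall i, alg_int (D%:R * sg i u).
  have H i : exists D : nat, (0 < D)%N /\ alg_int (D%:R * sg i u).
    by have [D D0 HD] := alg_int_denom (sg_alg i u); exists D.
  have [D HD] := choice H; exists (\prod_i D i)%N; split.
    by apply: prodn_gt0 => i; case: (HD i).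
  move=> i; rewrite (bigD1 i) //= natrM -mulrA mulrCA.
  by apply: integral_mul; [apply: integral_nat|case: (HD i)].
have [[Dx [Dx0 Hx]] [Dy [Dy0 Hy]] [Dz [Dz0 Hz]]] := And3 (den1 x) (den1 y) (den1 z).
exists (Dx * Dy * Dz)%N; split; first by rewrite !muln_gt0 Dx0 Dy0.
have alg n t : alg_int t -> alg_int (n%:R * t) by apply: integral_mul; apply: integral_nat.
move=> u Hu i; case: Hu => ->.
- have -> : (Dx * Dy * Dz)%:R * sg i x = (Dy * Dz)%:R * (Dx%:R * sg i x) by rewrite !natrM; ring.
  by apply: alg.
- have -> : (Dx * Dy * Dz)%:R * sg i y = (Dx * Dz)%:R * (Dy%:R * sg i y) by rewrite !natrM; ring.
  by apply: alg.
- have -> : (Dx * Dy * Dz)%:R * sg i z = (Dx * Dy)%:R * (Dz%:R * sg i z) by rewrite !natrM; ring.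
  by apply: alg.
Qed.

Lemma box_ex x y z : exists b r, boxed (tri x y z) b r.
Proof.
have [D [D0 HD]] := tri_denom x y z.
pose q : rat := D%:R ^- #|I|.
have q0 : 0 < q by rewrite invr_gt0 exprn_gt0 // ltr0n.
exists (fun i => cabs (sg i x) + cabs (sg i y) + cabs (sg i z)), (ln (ratr q)).
have le3 (e f g t : R) : 0 <= e -> 0 <= f -> 0 <= g ->
    [\/ t = e, t = f | t = g] -> t <= expR (e + f + g).
  move=> e0 f0 g0 H; apply: le_trans _ (expR_ge1Dx _).
  by case: H => ->; lra.
split; last exact: radical_ln.
  move=> u Hu i; apply: le3; rewrite ?cabs_ge0 //.
  by case: Hu => ->; [constructor 1|constructor 2|constructor 3].
move=> k Hk; rewrite expRN lnK ?posrE ?ltr0q // -fmorphV fmorphV.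
have -> : (ratr q)^-1%:C%C = \prod_(i : I) D%:R :> R[i].
  rewrite prodr_const -fmorphV /q invrK rmorphXn /= ratr_nat.
  by rewrite rmorphXn rmorph_nat.
rewrite -big_split /=; apply: alg_int_prod => i _; rewrite mulrC.
exact: HD.
Qed.

Lemma boxed_sub X Y b r : (forall x, Y x -> X x) -> boxed X b r -> boxed Y b r.
Proof. by move=> YX [Ha Hf Hr]; split=> //; [apply: arch_sub Ha|apply: fin_sub Hf]. Qed.

Lemma hgt_has_inf x y z : x != 0 ->
  has_inf [set s | exists b r, boxed (tri x y z) b r /\ s = box_size b r].
Proof.
move=> x0; split.
  by have [b [r H]] := box_ex x y z; exists (box_size b r), b, r.
exists 0 => _ [b [r [H ->]]]; apply: liouville H _ x0; exact: Or31.
Qed.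

Lemma hgt_le x y z b r : x != 0 -> boxed (tri x y z) b r -> hgt x y z <= box_size b r.
Proof.
by move=> x0 H; apply: ge_inf; [case: (hgt_has_inf y z x0)|exists b, r].
Qed.

Lemma hgt_approx x y z e : x != 0 -> 0 < e ->
  exists b r, boxed (tri x y z) b r /\ box_size b r < hgt x y z + e.
Proof.
move=> x0 e0; have [_ [b [r [H ->]]] lt] := inf_adherent e0 (hgt_has_inf y z x0).
by exists b, r.
Qed.

Lemma hgt_ge0 x y z : x != 0 -> 0 <= hgt x y z.
Proof.
move=> x0; apply: lb_le_inf; first by case: (hgt_has_inf y z x0).
move=> _ [b [r [H ->]]]; apply: liouville H _ x0; exact: Or31.
Qed.

(** How every upper bound for a height is obtained: by transforming boxes of two given
points into a box of the new one. *)
Lemma hgt_bound2 x y z x' y' z' u v w (K K' c : R) :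
  x != 0 -> x' != 0 -> u != 0 -> 0 <= K -> 0 <= K' ->
  (forall b r b' r', boxed (tri x y z) b r -> boxed (tri x' y' z') b' r' ->
    exists b2 r2, boxed (tri u v w) b2 r2 /\
      box_size b2 r2 <= K * box_size b r + K' * box_size b' r' + c) ->
  hgt u v w <= K * hgt x y z + K' * hgt x' y' z' + c.
Proof.
move=> x0 x'0 u0 K0 K'0 H; apply/ler_addgt0Pr => e e0.
pose d := e / (K + K' + 1).
have KK : 0 < K + K' + 1 by rewrite ltr_wpDl // addr_ge0.
have d0 : 0 < d by rewrite divr_gt0.
have [b [r [Hb lt]]] := hgt_approx y z x0 d0.
have [b' [r' [Hb' lt']]] := hgt_approx y' z' x'0 d0.
have [b2 [r2 [Hb2 le2]]] := H _ _ _ _ Hb Hb'.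
apply: le_trans (hgt_le u0 Hb2) _; apply: le_trans le2 _.
have : K * box_size b r <= K * (hgt x y z + d) by rewrite ler_wpM2l // ltW.
have : K' * box_size b' r' <= K' * (hgt x' y' z' + d) by rewrite ler_wpM2l // ltW.
have : d * (K + K' + 1) = e by rewrite /d divfK // gt_eqF.
nra.
Qed.

Lemma hgt_bound x y z u v w (K c : R) :
  x != 0 -> u != 0 -> 0 <= K ->
  (forall b r, boxed (tri x y z) b r ->
    exists b2 r2, boxed (tri u v w) b2 r2 /\
      box_size b2 r2 <= K * box_size b r + c) ->
  hgt u v w <= K * hgt x y z + c.
Proof.
move=> x0 u0 K0 H.
have := @hgt_bound2 x y z x y z u v w K 0 c x0 x0 u0 K0 (lexx 0).
rewrite mul0r addr0; apply => b r b' r' Hb _.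
by rewrite mul0r addr0; apply: H.
Qed.

Let dI : #|I|%:R != 0 :> R.
Proof. by rewrite pnatr_eq0 -lt0n. Qed.

Lemma box_sizeD b b' r r' :
  box_size (fun i => b i + b' i) (r + r') = box_size b r + box_size b' r'.
Proof. by rewrite /box_size big_split /=; field. Qed.

Lemma box_sizeZ b r (c : R) : box_size (fun i => c * b i) (c * r) = c * box_size b r.
Proof. by rewrite /box_size -mulr_sumr; field. Qed.

Lemma box_size_const (c : R) : box_size (fun=> c) 0 = c.
Proof. by rewrite /box_size sumr_const subr0 -[c *+ _]mulr_natr mulfK. Qed.

Lemma hgtX_le x y z n : x != 0 -> hgt (x ^+ n) (y ^+ n) (z ^+ n) <= n%:R * hgt x y z.
Proof.
move=> x0; rewrite -[leRHS]addr0; apply: hgt_bound => //; rewrite ?expf_neq0 // ?ler0n //.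
move=> b r [Ha Hf Hr]; exists (fun i => n%:R * b i), (n%:R * r); split; last first.
  by rewrite box_sizeZ addr0.
have root u : tri (x ^+ n) (y ^+ n) (z ^+ n) u -> exists t, tri x y z t /\ u = t ^+ n.
  by case=> ->; [exists x|exists y|exists z]; split=> //; [constructor 1|constructor 2|constructor 3].
split; last exact: radicalMn.
  move=> _ /root [t [Ht ->]] i; rewrite rmorphXn cabsX expRM_natl lerXn2r ?nnegrE ?cabs_ge0 ?expR_ge0 //.
  exact: Ha.
move=> k Hk; have [t Ht] := choice (fun i => root _ (Hk i)).
have -> : \prod_i sg i (k i) * (expR (- (n%:R * r)))%:C%C = (\prod_i sg i (t i) * (expR (- r))%:C%C) ^+ n.
  rewrite exprMn -rmorphXn /= -expRM_natl mulrN -prodrXl; congr (_ * _).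
  by apply: eq_bigr => i _; rewrite -rmorphXn; case: (Ht i) => _ ->.
by apply: alg_intX; apply: Hf => i; case: (Ht i).
Qed.

(** The n-th root of a box of the powers is a box, since an n-th root of an algebraic
integer is one. *)
Lemma hgtX_ge x y z n : (0 < n)%N -> x != 0 ->
  n%:R * hgt x y z <= hgt (x ^+ n) (y ^+ n) (z ^+ n).
Proof.
move=> n0 x0; have nR : 0 < n%:R :> R by rewrite ltr0n.
rewrite mulrC -ler_pdivlMr // mulrC -[leRHS]addr0.
apply: hgt_bound => //; rewrite ?expf_neq0 // ?invr_ge0 ?ler0n //.
move=> b r [Ha Hf Hr]; exists (fun i => n%:R^-1 * b i), (n%:R^-1 * r); split; last first.
  by rewrite box_sizeZ addr0.
have pw u : tri x y z u -> tri (x ^+ n) (y ^+ n) (z ^+ n) (u ^+ n).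
  by case=> ->; [constructor 1|constructor 2|constructor 3].
have E (t : R) : n%:R^-1 * t * n%:R = t by field; rewrite gt_eqF.
split; last by rewrite mulrC; apply: radical_div.
  move=> u Hu i; rewrite -(@ler_pXn2r _ n) ?nnegrE ?cabs_ge0 ?expR_ge0 //.
  by rewrite -expRM_natr E -cabsX -rmorphXn; apply/Ha/pw.
move=> k Hk; apply: (alg_int_root n0).
rewrite exprMn -rmorphXn /= -expRM_natr mulNr E -prodrXl.
under eq_bigr do rewrite -rmorphXn.
by apply: (Hf (fun i => k i ^+ n)) => i; apply: pw.
Qed.

Lemma hgtX x y z n : x != 0 -> hgt (x ^+ n) (y ^+ n) (z ^+ n) = n%:R * hgt x y z.
Proof.
move=> x0; apply/eqP; rewrite eq_le hgtX_le //; case: n => [|n]; last exact: hgtX_ge.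
by rewrite mul0r !expr0 hgt_ge0 ?oner_eq0.
Qed.

(** The norm of the factor l changes the archimedean and the finite part by opposite
amounts. *)
Lemma hgtZ_le l x y z : l != 0 -> x != 0 -> hgt (l * x) (l * y) (l * z) <= hgt x y z.
Proof.
move=> l0 x0; rewrite -[leRHS]mul1r -[leRHS]addr0.
apply: hgt_bound; rewrite ?ler01 ?mulf_neq0 // => b r [Ha Hf Hr].
have [q Hq] := norm_rat l.
have q0 : q != 0.
  rewrite -(fmorph_eq0 (@ratr R[i])) /= -Hq.
  by apply/prodf_neq0 => i _; rewrite sg_eq0.
have cl i : 0 < cabs (sg i l) by rewrite cabs_gt0 sg_eq0.
have nq : 0 < `|q| by rewrite normr_gt0.
exists (fun i => ln (cabs (sg i l)) + b i), (ln (ratr `|q|) + r).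
have sc u : tri (l * x) (l * y) (l * z) u -> exists t, tri x y z t /\ u = l * t.
  by case=> ->; [exists x|exists y|exists z]; split=> //; [constructor 1|constructor 2|constructor 3].
split; last first.
  rewrite box_sizeD mul1r addr0 -[leRHS]add0r lerD2r /box_size.
  suff -> : \sum_i ln (cabs (sg i l)) = ln (ratr `|q|) by rewrite subrr mul0r.
  apply: expR_inj; rewrite lnK ?posrE ?ltr0q // expR_sum.
  under eq_bigr do rewrite /= lnK ?posrE //.
  rewrite -cabs_prod Hq; apply: (@complexI R); rewrite cabsE.
  rewrite -ratr_norm -[LHS]/(ratr `|q|).
  by rewrite -[RHS]/(real_complex R (ratr `|q|)) fmorph_rat.
split; last by apply: radicalD => //; apply: radical_ln.
  move=> _ /sc [t [Ht ->]] i; rewrite rmorphM cabsM expRD lnK ?posrE //.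
  by rewrite ler_pM2l //; apply: Ha.
move=> k Hk; have [t Ht] := choice (fun i => sc _ (Hk i)).
have -> : \prod_i sg i (k i) * (expR (- (ln (ratr `|q|) + r)))%:C%C =
   ratr (q / `|q|) * (\prod_i sg i (t i) * (expR (- r))%:C%C).
  rewrite opprD expRD (expRN (ln _)) lnK ?posrE ?ltr0q // rmorphM /=.
  have -> : (ratr `|q|)^-1%:C%C = ratr (`|q|^-1) :> R[i].
    by rewrite -fmorphV -[LHS]/(real_complex R (ratr `|q|^-1)) fmorph_rat.
  have -> : \prod_i sg i (k i) = ratr q * \prod_i sg i (t i).
    rewrite -Hq -big_split; apply: eq_bigr => i _ /=.
    by case: (Ht i) => _ ->; rewrite rmorphM.
  by rewrite (rmorphM (@ratr R[i])) /=; ring.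
apply: integral_mul; last by apply: Hf => i; case: (Ht i).
have : q / `|q| = 1 \/ q / `|q| = -1.
  have [q_ge|q_lt] := leP 0 q; first by left; rewrite ger0_norm // divff.
  by right; rewrite ltr0_norm // invrN mulrN divff.
by case=> ->; rewrite ?rmorphN rmorph1; [|apply: integral_opp]; apply: integral1.
Qed.

Lemma hgtZ l x y z : l != 0 -> x != 0 -> hgt (l * x) (l * y) (l * z) = hgt x y z.
Proof.
move=> l0 x0; apply/eqP; rewrite eq_le hgtZ_le //=.
have := @hgtZ_le l^-1 (l * x) (l * y) (l * z); rewrite !mulKf //.
by apply; rewrite ?invr_eq0 ?mulf_neq0.
Qed.

Lemma boxed_mul X Y b b' r r' : boxed X b r -> boxed Y b' r' ->
  boxed (mulset X Y) (fun i => b i + b' i) (r + r').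
Proof.
move=> [Ha Hf Hr] [Ha' Hf' Hr'].
by split; [apply: arch_mul|apply: fin_mul|apply: radicalD].
Qed.

Lemma hgtM x y z x' y' z' : x != 0 -> x' != 0 ->
  hgt (x * x') (y * y') (z * z') <= hgt x y z + hgt x' y' z'.
Proof.
move=> x0 x'0; have := @hgt_bound2 x y z x' y' z' (x * x') (y * y') (z * z') 1 1 0 x0 x'0.
rewrite !mul1r addr0; apply; rewrite ?ler01 ?mulf_neq0 // => b r b' r' H H'.
exists (fun i => b i + b' i), (r + r'); split; last by rewrite box_sizeD !mul1r addr0.
apply: boxed_sub (boxed_mul H H') => u [] ->.
- by exists x, x'; split=> //; constructor 1.
- by exists y, y'; split=> //; constructor 2.
- by exists z, z'; split=> //; constructor 3.
Qed.

(** Up to the factor 1 / (x y z), the inverses are the products of two coordinates. *)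
Lemma hgtV x y z : x != 0 -> y != 0 -> z != 0 ->
  hgt x^-1 y^-1 z^-1 <= 2 * hgt x y z.
Proof.
move=> x0 y0 z0; rewrite -(@hgtZ (x * y * z)) ?mulf_neq0 ?invr_eq0 //.
have -> : x * y * z / x = y * z by field.
have -> : x * y * z / y = x * z by field.
have -> : x * y * z / z = x * y by field.
rewrite -[leRHS]addr0; apply: hgt_bound; rewrite ?ler0n ?mulf_neq0 // => b r H.
exists (fun i => b i + b i), (r + r); split; last by rewrite box_sizeD addr0 mulr_natl.
apply: boxed_sub (boxed_mul H H) => u [] ->.
- by exists y, z; split=> //; [constructor 2|constructor 3].
- by exists x, z; split=> //; [constructor 1|constructor 3].
- by exists x, y; split=> //; [constructor 1|constructor 2].
Qed.

(** In dimension 3 a vector orthogonal to two independent ones is a multiple of their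
cross product. *)
Lemma cross_line (x y z v1 v2 v3 w1 w2 w3 : L) :
  x != 0 -> v1 * w2 - v2 * w1 != 0 ->
  v1 * x + v2 * y + v3 * z = 0 -> w1 * x + w2 * y + w3 * z = 0 ->
  exists l, [/\ l != 0, x = l * (v2 * w3 - v3 * w2), y = l * (v3 * w1 - v1 * w3)
    & z = l * (v1 * w2 - v2 * w1)].
Proof.
move=> x0 d0 Ev Ew; set d := v1 * w2 - v2 * w1 in d0 *.
have Ex : x = z / d * (v2 * w3 - v3 * w2).
  apply: (mulIf d0); rewrite mulrAC divfK //.
  transitivity (w2 * (v1 * x + v2 * y + v3 * z) - v2 * (w1 * x + w2 * y + w3 * z)
      + z * (v2 * w3 - v3 * w2)); first by rewrite /d; ring.
  by rewrite Ev Ew !mulr0 subrr add0r.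
exists (z / d); split=> //.
- by apply: contra_neq x0 => e; rewrite Ex e mul0r.
- apply: (mulIf d0); rewrite mulrAC divfK //.
  transitivity (v1 * (w1 * x + w2 * y + w3 * z) - w1 * (v1 * x + v2 * y + v3 * z)
      + z * (v3 * w1 - v1 * w3)); first by rewrite /d; ring.
  by rewrite Ev Ew !mulr0 subrr add0r.
- by rewrite divfK.
Qed.

Lemma zspanB X x y : zspan X x -> zspan X y -> zspan X (x - y).
Proof. by move=> Hx Hy; apply: zspanD => //; apply: zspanN. Qed.

Lemma boxed_cross v1 v2 v3 w1 w2 w3 b r b' r' :
  boxed (tri v1 v2 v3) b r -> boxed (tri w1 w2 w3) b' r' ->
  boxed (tri (v2 * w3 - v3 * w2) (v3 * w1 - v1 * w3) (v1 * w2 - v2 * w1))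
    (fun i => b i + b' i + ln 2) (r + r').
Proof.
move=> Hb Hb'; have [Ha Hf Hr] := boxed_mul Hb Hb'.
have dec t : tri (v2 * w3 - v3 * w2) (v3 * w1 - v1 * w3) (v1 * w2 - v2 * w1) t ->
    exists t1 t2, [/\ t = t1 - t2, mulset (tri v1 v2 v3) (tri w1 w2 w3) t1
      & mulset (tri v1 v2 v3) (tri w1 w2 w3) t2].
  have [V1 V2 V3] : [/\ tri v1 v2 v3 v1, tri v1 v2 v3 v2 & tri v1 v2 v3 v3].
    by split; [constructor 1|constructor 2|constructor 3].
  have [W1 W2 W3] : [/\ tri w1 w2 w3 w1, tri w1 w2 w3 w2 & tri w1 w2 w3 w3].
    by split; [constructor 1|constructor 2|constructor 3].
  case=> ->.
  - by exists (v2 * w3), (v3 * w2); split=> //; [exists v2, w3|exists v3, w2].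
  - by exists (v3 * w1), (v1 * w3); split=> //; [exists v3, w1|exists v1, w3].
  - by exists (v1 * w2), (v2 * w1); split=> //; [exists v1, w2|exists v2, w1].
split=> //.
  move=> t /dec [t1 [t2 [-> H1 H2]]] i; rewrite expRD lnK ?posrE ?ltr0n // rmorphB.
  apply: le_trans (cabsD _ _) _; rewrite cabsN.
  by have := Ha _ H1 i; have := Ha _ H2 i; lra.
apply: fin_sub (fin_zspan Hf) => t /dec [t1 [t2 [-> H1 H2]]].
by apply: zspanB; apply: zspan_in.
Qed.

Lemma boxed1 : boxed (eq^~ 1) (fun=> 0) 0.
Proof.
split; last exact: radical0.
  by move=> _ -> i; rewrite rmorph1 cabs1 expR0.
move=> k Hk; rewrite oppr0 expR0 rmorph1 mulr1 big1 => [|i _]; first exact: integral1.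
by rewrite Hk rmorph1.
Qed.

Lemma hgt_cross x y z v1 v2 v3 w1 w2 w3 b' r' : x != 0 -> v1 != 0 ->
  v1 * w2 - v2 * w1 != 0 ->
  v1 * x + v2 * y + v3 * z = 0 -> w1 * x + w2 * y + w3 * z = 0 ->
  boxed (tri w1 w2 w3) b' r' ->
  hgt x y z <= hgt v1 v2 v3 + (box_size b' r' + ln 2).
Proof.
move=> x0 v0 d0 Ev Ew Hb'.
have [l [l0 Ex Ey Ez]] := cross_line x0 d0 Ev Ew.
have X0 : v2 * w3 - v3 * w2 != 0 by apply: contra_neq x0 => e; rewrite Ex e mulr0.
rewrite Ex Ey Ez hgtZ // -[X in _ <= X + _]mul1r.
apply: hgt_bound; rewrite ?ler01 // => b r Hb.
exists (fun i => b i + b' i + ln 2), (r + r'); split; first exact: boxed_cross.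
by rewrite -[r + r']addr0 !box_sizeD box_size_const mul1r addrA.
Qed.

(** The vectors (u : v : w) and (1 : 1 : 1) are both orthogonal to (x : y : z), which is
therefore their cross product. *)
Lemma hgt_gap x y z u v w : x != 0 -> z != 0 -> u != 0 ->
  x + y + z = 0 -> u * x + v * y + w * z = 0 ->
  (u != v) || (v != w) -> hgt x y z <= hgt u v w + ln 2.
Proof.
move=> x0 z0 u0 s0 us0 ne.
have B1 : boxed (tri 1 1 1) (fun=> 0) 0 by apply: boxed_sub boxed1 => t [].
have uv : u - v != 0.
  rewrite subr_eq0; apply: contraTneq ne => uv; rewrite uv eqxx /= negbK.
  have : (w - v) * z = (u * x + v * y + w * z) - v * (x + y + z) by rewrite uv; ring.
  rewrite us0 s0 mulr0 subrr => /eqP.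
  by rewrite mulf_eq0 (negPf z0) orbF subr_eq0 eq_sym.
rewrite -[ln 2]add0r -{1}(box_size_const 0).
by apply: hgt_cross B1; rewrite ?mulr1 ?mul1r.
Qed.

Fixpoint powset X n : L -> Prop :=
  if n is n'.+1 then mulset X (powset X n') else eq^~ 1.

Lemma boxed_pow X b r n : boxed X b r ->
  boxed (powset X n) (fun i => n%:R * b i) (n%:R * r).
Proof.
move=> H; elim: n => [|n IH].
  have -> : (fun i => 0%:R * b i) = fun=> 0 by apply: funext => i; rewrite mul0r.
  by rewrite mul0r; apply: boxed1.
have -> : (fun i => n.+1%:R * b i) = (fun i => b i + n%:R * b i).
  by apply: funext => i; rewrite -natr1; ring.
have -> : n.+1%:R * r = r + n%:R * r by rewrite -natr1; ring.
exact: boxed_mul.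
Qed.

Lemma powset_exp X x n : X x -> powset X n (x ^+ n).
Proof. by move=> Xx; elim: n => //= n IH; rewrite exprS; exists x, (x ^+ n). Qed.

Lemma powset_mul X m n s t : powset X m s -> powset X n t -> powset X (m + n) (s * t).
Proof.
elim: m s => [|m IH] s /=; first by move=> ->; rewrite mul1r.
move=> [x [y [Xx Hy ->]]] Ht; exists x, (y * t); split=> //; first exact: IH.
by rewrite mulrA.
Qed.

Lemma char0L (m : int) : (m%:~R == 0 :> L) = (m == 0).
Proof.
have /card_gt0P [i _] := I_gt0.
by rewrite -(fmorph_eq0 (sg i)) rmorph_int intr_eq0.
Qed.

(** The homogeneous form of degree n of A(- y / x). *)
Definition homog (A : {poly int}) n x y : L :=
  \sum_(j < n.+1) (A`_j)%:~R * ((- y) ^+ j * x ^+ (n - j)).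

Lemma homogE (A : {poly int}) n (x y : L) : x != 0 -> (size A <= n.+1)%N ->
  homog A n x y = x ^+ n * (map_poly intr A).[- y / x].
Proof.
move=> x0 sA; rewrite (@horner_coef_wide _ n.+1) ?(leq_trans (size_poly _ _)) //.
rewrite mulr_sumr; apply: eq_bigr => j _; rewrite coef_map /=.
have jn : (j <= n)%N by rewrite -ltnS.
have -> : x ^+ n = x ^+ (n - j) * x ^+ j by rewrite -exprD subnK.
rewrite expr_div_n; field; exact: expf_neq0.
Qed.

Lemma homog_zspan (A : {poly int}) n (x y z : L) : zspan (powset (tri x y z) n) (homog A n x y).
Proof.
apply: zspan_sum => j _; have jn : (j <= n)%N by rewrite -ltnS.
rewrite exprNn -signr_odd -mulrA.
have H : zspan (powset (tri x y z) n) ((A`_j)%:~R * (y ^+ j * x ^+ (n - j))).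
  apply: zspanMz; apply: zspan_in; rewrite -[in powset _ _](subnKC jn).
  by apply: powset_mul; apply: powset_exp; [constructor 2|constructor 1].
by case: odd; rewrite ?expr0 ?mul1r // expr1 mulN1r mulrN; apply: zspanN.
Qed.

Lemma homog_arch (A : {poly int}) n (x y z : L) b (M : nat) i : (forall k, `|A`_k| <= M%:Z) ->
  arch_bounded (powset (tri x y z) n) b ->
  cabs (sg i (homog A n x y)) <= (n.+1 * M)%N%:R * expR (b i).
Proof.
move=> HA Hb; rewrite rmorph_sum; apply: le_trans (cabs_sum _ _ _) _.
have -> : (n.+1 * M)%N%:R * expR (b i) = \sum_(j < n.+1) M%:R * expR (b i).
  by rewrite sumr_const card_ord natrM -[RHS]mulr_natl mulrA.
apply: ler_sum => j _; have jn : (j <= n)%N by rewrite -ltnS.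
rewrite rmorphM rmorph_int cabsM cabs_int; apply: ler_pM; rewrite ?cabs_ge0 ?ler0z //.
  by rewrite -[M%:R]/((Posz M)%:~R) ler_int.
rewrite exprNn -signr_odd -mulrA rmorphM rmorph_sign cabsM.
have -> : cabs ((-1) ^+ odd j : R[i]) = 1 by case: odd; rewrite ?cabsN cabs1.
rewrite mul1r; apply: Hb; rewrite -[in powset _ _](subnKC jn).
by apply: powset_mul; apply: powset_exp; [constructor 2|constructor 1].
Qed.

(** On the line x + y + z = 0 one has z ^ (2 n) = (x (1 - w)) ^ (2 n) with w = - y / x, so
the identity of an approximant is orthogonality of (x ^ (2 n), y ^ (2 n), z ^ (2 n)) to
the vector of its homogenized polynomials, whose height is at most n times that of
(x : y : z), up to O(n).  Against the degree 2 n of the left-hand side this saves n. *)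
Lemma hgt_pade (x y z x' y' z' : L) n : (0 < n)%N ->
  [/\ x != 0, y != 0 & z != 0] -> [/\ x' != 0, y' != 0 & z' != 0] ->
  x + y + z = 0 -> x' + y' + z' = 0 ->
  n%:R * hgt x y z <= hgt (x' / x ^+ (2 * n)) (y' / y ^+ (2 * n)) (z' / z ^+ (2 * n))
     + n%:R * (11 * ln 2).
Proof.
move=> n0 [x0 y0 z0] [x'0 y'0 z'0] s0 s'0.
set v1 := x' / _; set v2 := y' / _; set v3 := z' / _.
have Xn (u : L) : u != 0 -> u ^+ (2 * n) != 0 by move=> ?; apply: expf_neq0.
have v10 : v1 != 0 by rewrite mulf_neq0 ?invr_eq0 ?Xn.
have Ev : v1 * x ^+ (2 * n) + v2 * y ^+ (2 * n) + v3 * z ^+ (2 * n) = 0.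
  by rewrite !divfK ?Xn.
have main (A B C : {poly int}) :
   [/\ (size A <= n.+1)%N, (size B <= n.+1)%N & (size C <= n.+1)%N] ->
   A + 'X^(2 * n) * B = (1 - 'X) ^+ (2 * n) * C ->
   (forall k, [/\ `|A`_k| <= (2 ^ (9 * n))%N%:Z, `|B`_k| <= (2 ^ (9 * n))%N%:Z &
       `|C`_k| <= (2 ^ (9 * n))%N%:Z]) ->
   v1 * homog B n x y - v2 * homog A n x y != 0 ->
   n%:R * hgt x y z <= hgt v1 v2 v3 + n%:R * (11 * ln 2).
  move=> [sA sB sC] E bnd d0.
  have Ew : homog A n x y * x ^+ (2 * n) + homog B n x y * y ^+ (2 * n)
      + - homog C n x y * z ^+ (2 * n) = 0.
    rewrite !homogE //; set w := - y / x.
    have -> : y ^+ (2 * n) = x ^+ (2 * n) * w ^+ (2 * n).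
      by rewrite -exprMn /w mulrC divfK // !exprM sqrrN.
    have -> : z ^+ (2 * n) = x ^+ (2 * n) * (1 - w) ^+ (2 * n).
      rewrite -exprMn; have -> : x * (1 - w) = - z.
        by rewrite mulrBr mulr1 /w mulrC divfK // opprK; apply/eqP; rewrite -addr_eq0 s0.
      by rewrite !exprM sqrrN.
    have := congr1 (fun P => (map_poly intr P : {poly L}).[w]) E.
    rewrite !rmorphD !rmorphM !rmorphXn /= rmorphB /= rmorph1 map_polyX !hornerE /= => Ew.
    transitivity (x ^+ n * x ^+ (2 * n) * ((map_poly intr A).[w]
      + w ^+ (2 * n) * (map_poly intr B).[w] - (1 - w) ^+ (2 * n) * (map_poly intr C).[w])).
      by ring.
    by rewrite Ew subrr mulr0.
  have H : forall b r, boxed (tri x y z) b r ->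
      2 * n%:R * hgt x y z <= hgt v1 v2 v3 + (n%:R * box_size b r + n%:R * (11 * ln 2)).
    move=> b r Hb.
    have [Ha Hf Hr] := boxed_pow n Hb.
    have Hb' : boxed (tri (homog A n x y) (homog B n x y) (- homog C n x y))
       (fun i => n%:R * b i + n%:R * (10 * ln 2)) (n%:R * r + 0).
      rewrite addr0; split=> //.
        have le (P : {poly int}) i : (forall k, `|P`_k| <= (2 ^ (9 * n))%N%:Z) ->
            cabs (sg i (homog P n x y)) <= expR (n%:R * b i + n%:R * (10 * ln 2)).
          move=> HP; apply: le_trans (homog_arch (M := 2 ^ (9 * n)) i HP Ha) _.
          rewrite addrC expRD ler_pM2r ?expR_gt0 //.
          have -> : n%:R * (10 * ln 2) = (10 * n)%N%:R * ln 2 :> R by rewrite natrM; ring.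
          rewrite expRM_natl lnK ?posrE ?ltr0n // -natrX ler_nat.
          have -> : (10 * n = n + 9 * n)%N := mulSn 9 n.
          by rewrite expnD; apply: leq_mul => //; apply: ltn_expl.
        move=> t Ht i; have [A9 B9 C9] : [/\ (forall k, `|A`_k| <= (2 ^ (9 * n))%N%:Z),
           (forall k, `|B`_k| <= (2 ^ (9 * n))%N%:Z) & (forall k, `|C`_k| <= (2 ^ (9 * n))%N%:Z)].
          by split=> k; case: (bnd k).
        by case: Ht => ->; rewrite ?rmorphN ?cabsN; apply: le.
      apply: fin_sub (fin_zspan Hf) => t [] ->; [| |apply: zspanN]; exact: homog_zspan.
    have := hgt_cross (Xn _ x0) v10 d0 Ev Ew Hb'.
    rewrite hgtX // box_sizeD box_sizeZ box_size_const natrM => /le_trans; apply.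
    rewrite lerD2l -addrA lerD2l.
    have : ln 2 <= n%:R * ln 2 :> R.
      by rewrite ler_peMl ?ln_ge0 ?ler1n.
    lra.
  have : 2 * n%:R * hgt x y z - hgt v1 v2 v3 - n%:R * (11 * ln 2) <= n%:R * hgt x y z.
    have nR : 0 < n%:R :> R by rewrite ltr0n.
    rewrite -ler_pdivrMl //; apply: lb_le_inf; first by case: (hgt_has_inf y z x0).
    by move=> _ [b [r [Hb ->]]]; rewrite ler_pdivrMl //; have := H _ _ Hb; lra.
  lra.
have [A [B [C [A' [B' [C' [l [sz sz' [E E'] bnd [l0 det]]]]]]]]] := pade_pair n0.
have [d0|d0] := eqVneq (v1 * homog B n x y - v2 * homog A n x y) 0; last first.
  by apply: (main A B C) => // k; case: (bnd k).
apply: (main A' B' C') => //; first by move=> k; case: (bnd k).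
apply/negP => /eqP d'0.
case: sz sz' => sA sB _ [sA' sB' _].
have E0 : v1 * (homog A n x y * homog B' n x y - homog A' n x y * homog B n x y) = 0.
  transitivity (homog A n x y * (v1 * homog B' n x y - v2 * homog A' n x y)
    - homog A' n x y * (v1 * homog B n x y - v2 * homog A n x y)); first by ring.
  by rewrite d0 d'0 !mulr0 subrr.
have := congr1 (fun P => (map_poly intr P : {poly L}).[- y / x]) det.
rewrite !rmorphB !rmorphM !rmorphXn /= rmorphB /= rmorph1 map_polyX map_polyC !hornerE /=.
move/eqP: E0; rewrite mulf_eq0 (negPf v10) /= !homogE //.
set a := _.[_]; set b := _.[_]; set a' := _.[_]; set b' := _.[_] => E0.
have {}E0 : a * b - a' * b' = 0.
  have : (x ^+ n) ^+ 2 * (a * b - a' * b') = 0 by rewrite -(eqP E0); ring.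
  by move/eqP; rewrite mulf_eq0 sqrf_eq0 (negPf (expf_neq0 _ x0)) => /eqP.
rewrite E0 => /esym/eqP; rewrite mulf_eq0 char0L (negPf l0) /= expf_eq0 => /andP[_].
rewrite mulNr opprK => /eqP e; move: z0.
have : x * (1 + y / x) = - z.
  by rewrite mulrDr mulr1 mulrC divfK //; apply/eqP; rewrite -addr_eq0 s0.
by rewrite e mulr0 => /esym/eqP; rewrite oppr_eq0 => /eqP ->; rewrite eqxx.
Qed.

Lemma zspan_sub X Y t : (forall x, X x -> Y x) -> zspan X t -> zspan Y t.
Proof.
move=> XY; elim => {t} [x /XY Yx| |x y _ Hx _ Hy|x _ Hx].
- exact: zspan_in.
- exact: zspan0.
- exact: zspanD.
- exact: zspanN.
Qed.

Lemma zspan_powset_mul X m n s t : zspan (powset X m) s -> zspan (powset X n) t ->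
  zspan (powset X (m + n)) (s * t).
Proof.
move=> Hs Ht; apply: zspan_sub (zspan_mul Hs Ht) => _ [x [y [Xx Yy ->]]].
exact: powset_mul.
Qed.

(** The defect of additivity of the 7th power, divided by 7. *)
Definition frob7 (x y : L) := x * y * (x + y) * (x * x + x * y + y * y) * (x * x + x * y + y * y).

Lemma frob7E x y : (x + y) ^+ 7 = x ^+ 7 + y ^+ 7 + 7 * frob7 x y.
Proof. by rewrite /frob7; ring. Qed.

Lemma frob7_zspan X x y : zspan (powset X 1) x -> zspan (powset X 1) y ->
  zspan (powset X 7) (frob7 x y).
Proof.
move=> Hx Hy; have H2 : zspan (powset X 2) (x * x + x * y + y * y).
  by apply: zspanD; first apply: zspanD; apply: (@zspan_powset_mul X 1 1).
apply: (@zspan_powset_mul X 5 2) => //; apply: (@zspan_powset_mul X 3 2) => //.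
apply: (@zspan_powset_mul X 2 1); last exact: zspanD.
exact: (@zspan_powset_mul X 1 1).
Qed.

(** The two determinants are those of (1, 1, 1), (x1, y1, 1), (x2, y2, 1) and of the 7th
powers.  The first is a sum of 6 terms and vanishes, so the second, the sum D7 of the
7th powers of these terms, is - 7 E with E integral in the coordinates.  At the
archimedean places E is at most 6 / 7 times the product of the coordinate bounds,
which Liouville's inequality plays against the heights. *)
Lemma hgt_small_det x1 y1 x2 y2 : x1 != 0 -> x2 != 0 ->
  (x1 - 1) * (y2 - 1) = (x2 - 1) * (y1 - 1) ->
  (x1 ^+ 7 - 1) * (y2 ^+ 7 - 1) != (x2 ^+ 7 - 1) * (y1 ^+ 7 - 1) ->
  ln (7 / 6) <= 7 * (hgt x1 y1 1 + hgt x2 y2 1).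
Proof.
move=> x10 x20 E1 E7.
suff : 0 <= 7 * hgt x1 y1 1 + 7 * hgt x2 y2 1 + - ln (7 / 6) by lra.
have one0 : (1 : L) != 0 := oner_neq0 _.
suff H b r b' r' : boxed (tri x1 y1 1) b r -> boxed (tri x2 y2 1) b' r' ->
    ln (7 / 6) <= 7 * box_size b r + 7 * box_size b' r'.
  apply/ler_addgt0Pr => e e0.
  have d0 : 0 < e / 14 by lra.
  have [b [r [Hb lt]]] := hgt_approx y1 1 x10 d0.
  have [b' [r' [Hb' lt']]] := hgt_approx y2 1 x20 d0.
  have := H _ _ _ _ Hb Hb'; lra.
move=> Hb Hb'; pose M := mulset (tri x1 y1 1) (tri x2 y2 1).
have HM := boxed_mul Hb Hb'; rewrite -/M in HM.
have [Ha Hf Hr] := HM; have [Ha7 Hf7 Hr7] := boxed_pow 7 HM.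
have [m1 m2 m3] : [/\ M y1, M y2 & M x1].
  split; [exists y1, 1|exists 1, y2|exists x1, 1]; rewrite ?mulr1 ?mul1r;
    by split=> //; by [constructor 1|constructor 2|constructor 3].
have [m4 m5 m6] : [/\ M x2, M (x1 * y2) & M (x2 * y1)].
  split; [exists 1, x2|exists x1, y2|exists y1, x2]; rewrite ?mulr1 ?mul1r ?[y1 * _]mulrC;
    by split=> //; by [constructor 1|constructor 2|constructor 3].
have M1 t : M t -> zspan (powset M 1) t.
  by move=> Mt; apply: zspan_in; exists t, 1; rewrite mulr1.
pose s2 := y1 - y2; pose s3 := s2 - x1; pose s4 := s3 + x2; pose s5 := s4 + x1 * y2.
have z2 : zspan (powset M 1) s2 by apply: zspanB; apply: M1.
have z3 : zspan (powset M 1) s3 by apply: zspanB => //; apply: M1.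
have z4 : zspan (powset M 1) s4 by apply: zspanD => //; apply: M1.
have z5 : zspan (powset M 1) s5 by apply: zspanD => //; apply: M1.
have zN t : M t -> zspan (powset M 1) (- t) by move=> ?; apply: zspanN; apply: M1.
pose E := frob7 y1 (- y2) + frob7 s2 (- x1) + frob7 s3 x2 + frob7 s4 (x1 * y2) + frob7 s5 (- (x2 * y1)).
have zE : zspan (powset M 7) E.
  do 4 (apply: zspanD; last by apply: frob7_zspan; auto).
  by apply: frob7_zspan; auto.
pose D7 := y1 ^+ 7 - y2 ^+ 7 - x1 ^+ 7 + x2 ^+ 7 + (x1 * y2) ^+ 7 - (x2 * y1) ^+ 7.
have odd7 (t : L) : (- t) ^+ 7 = - t ^+ 7 by rewrite exprNn -signr_odd expr1 mulN1r.
have EE : D7 = - (7 * E).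
  have s60 : s5 + - (x2 * y1) = 0.
    transitivity ((x1 - 1) * (y2 - 1) - (x2 - 1) * (y1 - 1)); last by rewrite E1 subrr.
    by rewrite /s5 /s4 /s3 /s2; ring.
  have F (u v w : L) : w = u + v -> w ^+ 7 = u ^+ 7 + v ^+ 7 + 7 * frob7 u v.
    by move=> ->; apply: frob7E.
  have := frob7E s5 (- (x2 * y1)); rewrite s60 expr0n /=.
  rewrite (F s4 _ s5 erefl) (F s3 _ s4 erefl) (F s2 _ s3 erefl) (F y1 _ s2 erefl) !odd7 => H.
  by apply/eqP; rewrite -addr_eq0 [X in _ == X]H /D7 /E; apply/eqP; ring.
have E0 : E != 0.
  apply: contra_neq E7 => E0; apply/eqP; rewrite -subr_eq0; apply/eqP.
  transitivity D7; last by rewrite EE E0 mulr0 oppr0.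
  by rewrite /D7 !exprMn; ring.
have box : boxed (eq^~ E) (fun i => 7 * (b i + b' i) + ln (6 / 7)) (7 * (r + r') + 0).
  rewrite addr0; split=> //; last by apply: fin_sub (fin_zspan Hf7) => _ ->.
  move=> _ -> i; rewrite expRD lnK ?posrE; last by lra.
  set e := expR _; have le t : M t -> cabs (sg i (t ^+ 7)) <= e.
    by move=> Mt; apply: Ha7; apply: powset_exp.
  have : cabs (sg i D7) = 7 * cabs (sg i E).
    rewrite EE rmorphN cabsN rmorphM cabsM rmorph_nat.
    by rewrite -[7%:R]/(7%:~R) cabs_int.
  have : cabs (sg i D7) <= 6 * e.
    have tri6 (a1 a2 a3 a4 a5 a6 : R[i]) : cabs (a1 - a2 - a3 + a4 + a5 - a6) <=
        cabs a1 + cabs a2 + cabs a3 + cabs a4 + cabs a5 + cabs a6.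
      apply: le_trans (cabsD _ _) _; rewrite cabsN lerD2r.
      apply: le_trans (cabsD _ _) _; rewrite lerD2r.
      apply: le_trans (cabsD _ _) _; rewrite lerD2r.
      apply: le_trans (cabsD _ _) _; rewrite cabsN lerD2r.
      by apply: le_trans (cabsD _ _) _; rewrite cabsN.
    rewrite /D7 !(rmorphB, rmorphD) /=; apply: le_trans (tri6 _ _ _ _ _ _) _.
    by have := le _ m1; have := le _ m2; have := le _ m3; have := le _ m4;
       have := le _ m5; have := le _ m6; lra.
  lra.
have := liouville box (erefl E) E0.
rewrite box_sizeD box_size_const box_sizeZ box_sizeD.
have -> : (6 / 7 : R) = (7 / 6)^-1 by field.
by rewrite lnV ?posrE //; lra.
Qed.

(** If all determinants of 7th powers vanished, the 7th powers of the 8 points would lie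
on a line; substituting the equation of the given line, which contains (1, 1), would
give a nonzero polynomial of degree at most 7 with 8 roots. *)
Lemma hgt_small_points (X Y : nat -> L) (u1 u2 u3 : L) :
  u1 != 0 -> u2 != 0 -> u3 != 0 -> u1 + u2 + u3 = 0 ->
  (forall j, (j < 8)%N -> X j != 0 /\ u1 * X j + u2 * Y j + u3 = 0) ->
  (forall j k, (j < k < 8)%N -> X j != X k) ->
  exists j k, [/\ (j < 8)%N, (k < 8)%N &
    ln (7 / 6) <= 7 * (hgt (X j) (Y j) 1 + hgt (X k) (Y k) 1)].
Proof.
move=> u10 u20 u30 us HX Xinj.
pose D7 j k := (X j ^+ 7 - 1) * (Y k ^+ 7 - 1) - (X k ^+ 7 - 1) * (Y j ^+ 7 - 1).
have line j : (j < 8)%N -> u1 * (X j - 1) = - u2 * (Y j - 1).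
  move=> j8; apply/eqP; rewrite -subr_eq0; apply/eqP.
  transitivity ((u1 * X j + u2 * Y j + u3) - (u1 + u2 + u3)); first by ring.
  by case: (HX j j8) => _ ->; rewrite us subrr.
suff [j [k [j8 k8 D0]]] : exists j k, [/\ (j < 8)%N, (k < 8)%N & D7 j k != 0].
  exists j, k; split=> //; apply: hgt_small_det.
  - by case: (HX j j8).
  - by case: (HX k k8).
  - apply: (mulfI u10); rewrite mulrA line // [in RHS]mulrA line //; ring.
  - by move: D0; rewrite subr_eq0.
apply: contrapT => no; have {no} D0 j k : (j < 8)%N -> (k < 8)%N -> D7 j k = 0.
  by move=> j8 k8; apply/eqP; apply: contrapT => /negP ne; apply: no; exists j, k.
pose c1 := - u1 / u2; pose c3 := - u3 / u2.
have YE j : (j < 8)%N -> Y j = c1 * X j + c3.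
  move=> /HX [_ H]; apply: (mulfI u20); rewrite mulrDr mulrA /c1 /c3 ![u2 * (_ / _)]mulrC !divfK //.
  by apply/eqP; rewrite -subr_eq0 -H; apply/eqP; ring.
pose Q (k l : L) : {poly L} := k%:P * ('X^7 - 1) + l%:P * ((c1%:P * 'X + c3%:P) ^+ 7 - 1).
have sl : (size (c1 *: 'X + c3%:P)%R <= 2)%N.
  apply: leq_trans (size_polyD _ _) _; rewrite geq_max.
  rewrite (leq_trans (size_scale_leq _ _)) ?size_polyX //.
  by rewrite (leq_trans (size_polyC_leq1 _)).
have sQ k l : (size (Q k l) <= 8)%N.
  apply: leq_trans (size_polyD _ _) _; rewrite geq_max !mul_polyC; apply/andP; split.
    apply: leq_trans (size_scale_leq _ _) _.
    by rewrite (size_XnsubC 1 (isT : (0 < 7)%N)).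
  apply: leq_trans (size_scale_leq _ _) _; apply: leq_trans (size_polyD _ _) _.
  rewrite geq_max size_polyN size_poly1 andbT.
  apply: leq_trans (size_poly_exp_leq _ _) _.
  by move: (size _) sl => [|[|[|m]]].
have Q0 k l : (forall j, (j < 8)%N -> k * (X j ^+ 7 - 1) + l * (Y j ^+ 7 - 1) = 0) ->
    k = 0 /\ l = 0.
  move=> H; have Qz : Q k l = 0.
    apply: (@roots_geq_poly_eq0 _ _ [seq X j | j <- iota 0 8]); last by rewrite size_map size_iota.
      apply/allP => x /mapP [j Hj ->]; move: Hj; rewrite mem_iota => /andP[_ j8].
      by rewrite /root /Q !hornerE -YE // H.
    rewrite ?uniq_rootsE map_inj_in_uniq ?iota_uniq // => i j.
    rewrite !mem_iota /= => i8 j8 e; have [lt|lt|//] := ltngtP i j.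
      by have := Xinj i j; rewrite lt j8 e eqxx => /(_ isT).
    by have := Xinj j i; rewrite lt i8 e eqxx => /(_ isT).
  have l0 : l = 0.
    have := congr1 (fun P => P^`().[0]) Qz; rewrite /Q derivD !derivM !derivC !mul0r !add0r.
    rewrite derivB derivXn (derivC 1) subr0 derivB (derivC 1) subr0 deriv_exp derivD derivM !derivC derivX.
    rewrite !(hornerD, hornerM, hornerC, hornerMn, horner_exp, hornerXn, hornerX) => H1.
    have : l * (7%:~R * (c1 * c3 ^+ 6)) = 0.
      by rewrite -[RHS]H1 /=; ring.
    have c10 : c1 != 0 by rewrite mulf_neq0 ?oppr_eq0 ?invr_eq0.
    have c30 : c3 != 0 by rewrite mulf_neq0 ?oppr_eq0 ?invr_eq0.
    have nz : 7%:~R * (c1 * c3 ^+ 6) != 0.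
      by rewrite mulf_neq0 ?char0L // mulf_neq0 // expf_neq0.
    by move/eqP; rewrite mulf_eq0 (negPf nz) orbF => /eqP.
  have := congr1 (fun P => P.[0]) Qz; rewrite /Q l0 mul0r addr0.
  rewrite hornerM hornerC hornerD hornerN hornerXn (hornerC 1) horner0 => H1; split=> //.
  by rewrite -[RHS]oppr0 -[X in _ = - X]H1 /=; ring.
have [[j0 [j08 ne]]|all0] := pselect (exists j0, (j0 < 8)%N /\ (X j0 ^+ 7 - 1 != 0 \/ Y j0 ^+ 7 - 1 != 0)).
  have [kk ll] : Y j0 ^+ 7 - 1 = 0 /\ - (X j0 ^+ 7 - 1) = 0.
    by apply: Q0 => j j8; rewrite -(D0 j j0 j8 j08) /D7; ring.
  by case: ne => /eqP; [move/eqP: ll; rewrite oppr_eq0 => /eqP|].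
have [/eqP] : (1 : L) = 0 /\ (0 : L) = 0; last by rewrite oner_eq0.
apply: Q0 => j j8; rewrite mul0r addr0 mul1r; apply/eqP; apply: contrapT => /negP ne.
by apply: all0; exists j; split=> //; left.
Qed.

(** * Counting solutions of the unit equation in a number field *)

(** Windows of 8 solutions advance k * eta by 1 / 98, so 42 * 98 steps bring it to 6.  From
there on [h k >= k * eta / 3] turns the gap into growth by a factor 7 / 6; 22 further steps
make the index large compared with [h 0], and 12 more multiply it by 6, which contradicts
the Pade inequality. *)
Lemma gap_principle_bound (h : nat -> R) (eta : R) (t : nat -> nat) N : 0 <= h 0 -> 0 <= eta ->
  t 0 = 0%N -> (forall i j, (i < j <= N)%N -> (t i < t j)%N) ->
  (forall i, (i <= N)%N -> h 0 <= h (t i)) ->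
  (forall i j, (i < j <= N)%N -> h (t i) <= (t j - t i)%:R * eta + ln 2) ->
  (forall k, k%:R * eta <= h k + 2 * h 0) ->
  (forall i, (i + 7 <= N)%N -> 98^-1 <= (t (i + 7)%N - t i)%:R * eta) ->
  (forall i j n, (0 < n)%N -> (i <= N)%N -> (j <= N)%N -> (2 * n * t i <= t j)%N ->
    n%:R * h (t i) <=
      n%:R * (4 * h 0) + (t j - 2 * n * t i)%:R * eta + n%:R * (11 * ln 2)) ->
  (N < 4150)%N.
Proof.
set A := h 0; move=> A_ge0 eta_ge0 t0 t_incr h_min gap height_lower window pade_step.
rewrite ltnNge; apply/negP => N_ge.
have ln2 : ln 2 <= 1 :> R by have := @le_ln1Dx R 1; rewrite -[1 + 1]/(2%:R); lra.
have mono i j : (i <= j)%N -> (j <= N)%N -> (t i <= t j)%N.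
  by rewrite leq_eqVlt => /orP [/eqP -> //|ij] jN; apply/ltnW/t_incr; rewrite ij.
have windows k : (7 * k <= N)%N -> k%:R / 98 <= (t (7 * k)%N)%:R * eta.
  elim: k => [|k IH] kN; first by rewrite ?muln0 t0 !mul0r.
  have kN' : (7 * k <= N)%N by apply: leq_trans kN; apply: leq_mul.
  have e : (7 * k + 7 = 7 * k.+1)%N by rewrite addnC -mulnS.
  have := window (7 * k)%N; rewrite e => /(_ kN); have := IH kN'.
  rewrite natrB; last first.
    by apply: mono kN; apply: leq_mul.
  by rewrite -natr1; lra.
(* 588 = 6 * 98 windows of length 7. *)
pose J := (7 * 588)%N; pose T := (t J)%:R * eta.
have JN : (J <= N)%N by apply: leq_trans N_ge.
have T6 : 6 <= T.
  by have := windows _ JN; have -> : 588%:R / 98 = 6 :> R by field.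
have J0 : (0 < J)%N by [].
have JN34 : (J + 34 <= N)%N by apply: leq_trans N_ge.
move: J @T J0 JN JN34 T6 {N_ge} => J T J0 JN JN34 T6.
have AT : A <= 7 / 6 * T.
  have := gap 0 J; rewrite J0 JN t0 subn0 => /(_ isT); rewrite -/A -/T; lra.
have grow i s : (J <= i)%N -> (i + s <= N)%N ->
    (7 / 6) ^+ s * ((t i)%:R * eta) <= (t (i + s)%N)%:R * eta.
  move=> Ji; elim: s => [|s IH]; first by rewrite expr0 mul1r addn0.
  rewrite addnS => sN; have sN' := ltnW sN.
  have {IH} := IH sN'; rewrite exprS -mulrA; set p := _ ^+ s * _ => le.
  have ge6 : 6 <= (t (i + s)%N)%:R * eta.
    apply: le_trans T6 _; rewrite ler_wpM2r // ler_nat.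
    by apply: mono => //; apply: leq_trans Ji (leq_addr _ _).
  have := gap (i + s)%N (i + s).+1; rewrite ltnSn sN natrB; last exact: mono.
  move=> /(_ isT); have := height_lower (t (i + s)%N); have := h_min _ sN'; lra.
pose m := t (J + 22)%N.
have N22 : (J + 22 <= N)%N by apply: leq_trans JN34; rewrite leq_add2l.
have mT : 27 * T <= m%:R * eta.
  apply: le_trans (grow J 22%N (leqnn _) N22).
  by rewrite ler_wpM2r; lra.
pose m' := t (J + 34)%N.
have eta_gt0 : 0 < eta.
  by rewrite lt0r eta_ge0 andbT; apply/eqP => e; move: T6; rewrite /T e mulr0; lra.
have m0 : (0 < m)%N.
  by rewrite lt0n; apply/eqP => e; move: mT; rewrite e mul0r; lra.
have mm' : (6 * m <= m')%N.
  rewrite -(ler_nat R) -(ler_pM2r eta_gt0) natrM.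
  have := grow (J + 22)%N 12%N (leq_addr _ _); rewrite -addnA => /(_ JN34).
  rewrite -/m -/m'; apply: le_trans; rewrite -mulrA ler_wpM2r ?mulr_ge0 //; lra.
(* The exponent 2 n for which m' - 2 n m is between 0 and 2 m. *)
pose n := (m' %/ (2 * m))%N.
have m20 : (0 < 2 * m)%N by rewrite muln_gt0.
have n3 : (3 <= n)%N by rewrite leq_divRL // mulnA.
have nm : (2 * n * m <= m')%N by rewrite mulnAC mulnC leq_trunc_div.
have r2 : (m' - 2 * n * m <= 2 * m)%N.
  by rewrite [X in (X - _)%N](divn_eq m' (2 * m)) -/n mulnCA -mulnA addKn ltnW // ltn_mod.
have := pade_step (J + 22)%N (J + 34)%N n (leq_trans (isT : 0 < 3)%N n3) N22 JN34 nm.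
rewrite -/m -/m'; have := height_lower m.
have rr : (m' - 2 * n * m)%:R * eta <= 2 * (m%:R * eta).
  by rewrite mulrA ler_wpM2r // -natrM ler_nat.
have n3R : 3 <= n%:R :> R by rewrite ler_nat.
move=> low pad.
have : (n%:R - 2) * (m%:R * eta) <= n%:R * (6 * A + 11).
  have : n%:R * (m%:R * eta) <= n%:R * (h m + 2 * A) by rewrite ler_wpM2l.
  have : n%:R * (11 * ln 2) <= n%:R * 11 :> R by apply: ler_wpM2l; lra.
  lra.
have : (n%:R - 2) * (27 * T) <= (n%:R - 2) * (m%:R * eta) by apply: ler_wpM2l; lra.
have : n%:R * (6 * A + 11) <= n%:R * (53 / 6 * T).
  by apply: ler_wpM2l; lra.
have : 0 <= (n%:R - 3) * T by rewrite mulr_ge0 //; lra.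
lra.
Qed.

(** The solutions after one whose point has minimal height. *)
Section OneSided.
Variables a1 a2 be1 be2 : L.
Hypotheses (a10 : a1 != 0) (a20 : a2 != 0) (be10 : be1 != 0) (be20 : be2 != 0).
Variables (t : nat -> nat) (N : nat).
Hypothesis t0 : t 0 = 0%N.
Hypothesis t_incr : forall i j, (i < j <= N)%N -> (t i < t j)%N.
Hypothesis t_sol : forall i, (i <= N)%N -> a1 * be1 ^+ t i + a2 * be2 ^+ t i = 1.
Hypothesis t_dist : forall i j, (i < j <= N)%N ->
  be1 ^+ (t j - t i) != 1 \/ be2 ^+ (t j - t i) != 1.

Let h k := hgt (a1 * be1 ^+ k) (a2 * be2 ^+ k) (-1).
Let eta := hgt be1 be2 1.
Let A := h 0.
Hypothesis h_min : forall i, (i <= N)%N -> A <= h (t i).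

Let eta_ge0 : 0 <= eta. Proof. exact: hgt_ge0. Qed.
Let A_ge0 : 0 <= A. Proof. by apply: hgt_ge0; rewrite mulf_neq0 // expf_neq0. Qed.

Let hgt_be k : hgt (be1 ^+ k) (be2 ^+ k) 1 = k%:R * eta.
Proof. by rewrite -hgtX // expr1n. Qed.

Let c1_neq0 k : a1 * be1 ^+ k != 0. Proof. by rewrite mulf_neq0 // expf_neq0. Qed.
Let c2_neq0 k : a2 * be2 ^+ k != 0. Proof. by rewrite mulf_neq0 // expf_neq0. Qed.

Let m1_neq0 : (-1 : L) != 0. Proof. by rewrite oppr_eq0 oner_eq0. Qed.

Let sol_sum i : (i <= N)%N -> a1 * be1 ^+ t i + a2 * be2 ^+ t i + -1 = 0.
Proof. by move=> iN; rewrite t_sol // subrr. Qed.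

Let gap i j : (i < j <= N)%N -> h (t i) <= (t j - t i)%:R * eta + ln 2.
Proof.
move=> ij; have tij := ltnW (t_incr ij); case/andP: (ij) => lt jN.
rewrite -hgt_be; apply: hgt_gap; rewrite ?expf_neq0 //.
- by apply: sol_sum; apply: ltnW; apply: leq_trans lt jN.
- rewrite mulrCA -exprD subnK // mulrCA -exprD subnK // mul1r.
  exact: sol_sum.
- by case: (t_dist ij) => ne; rewrite ?ne ?orbT //; case: eqP => //= e; rewrite -e ne.
Qed.

Let height_lower k : k%:R * eta <= h k + 2 * A.
Proof.
rewrite -hgt_be.
have -> : be1 ^+ k = (a1 * be1 ^+ k) * (a1 * be1 ^+ 0)^-1 by rewrite expr0 mulr1 mulrAC divff // mul1r.
have -> : be2 ^+ k = (a2 * be2 ^+ k) * (a2 * be2 ^+ 0)^-1 by rewrite expr0 mulr1 mulrAC divff // mul1r.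
rewrite -{1}[1](@divff _ (-1 : L)) //.
apply: le_trans (hgtM _ _ _ _ _ _) _; rewrite ?invr_eq0 ?c1_neq0 //.
by rewrite lerD2l; apply: hgtV.
Qed.

Let window i : (i + 7 <= N)%N -> 98^-1 <= (t (i + 7)%N - t i)%:R * eta.
Proof.
move=> iN; set d := (t (i + 7)%N - t i)%N.
have mono j k : (j <= k)%N -> (k < 8)%N -> (t (i + j)%N <= t (i + k)%N)%N.
  rewrite leq_eqVlt => /orP [/eqP -> //|jk] k8.
  apply/ltnW/t_incr; rewrite ltn_add2l jk (leq_trans _ iN) //.
  by rewrite leq_add2l -ltnS.
pose X j := be1 ^+ (t (i + j)%N - t i); pose Y j := be2 ^+ (t (i + j)%N - t i).
have ti j : (j < 8)%N -> (t i <= t (i + j)%N)%N.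
  by move=> j8; have := mono 0 j (leq0n _) j8; rewrite addn0.
have line j : (j < 8)%N -> a1 * be1 ^+ t i * X j + a2 * be2 ^+ t i * Y j + -1 = 0.
  move=> j8; rewrite -!mulrA -!exprD subnKC; last exact: ti.
  by apply: sol_sum; apply: leq_trans iN; rewrite leq_add2l -ltnS.
have iN' : (i <= N)%N by apply: leq_trans iN; apply: leq_addr.
have [||j [k [j8 k8 le]]] := @hgt_small_points X Y _ _ _ (c1_neq0 (t i)) (c2_neq0 (t i)) m1_neq0 (sol_sum iN').
- by move=> j j8; split; [rewrite expf_neq0|exact: line].
- move=> j k jk; apply/eqP => e; case/andP: jk => jk k8; have j8 := ltn_trans jk k8.
  have eY : Y j = Y k.
    have := line j; have := line k; rewrite -e => lk lj.
    apply: (mulfI (c2_neq0 (t i))).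
    apply: (addrI (a1 * be1 ^+ t i * X j)); apply: (addIr (-1)).
    by rewrite lk ?lj.
  have E (b : L) : b != 0 -> b ^+ (t (i + j)%N - t i) = b ^+ (t (i + k)%N - t i) ->
      b ^+ (t (i + k)%N - t (i + j)%N) = 1.
    move=> b0 eb; have tij := ti j j8.
    have tjk := mono j k (ltnW jk) k8.
    apply: (mulfI (expf_neq0 (t (i + j)%N - t i) b0)).
    by rewrite -exprD mulr1 eb; congr (_ ^+ _); move: tij tjk; clear; lia.
  have [] : be1 ^+ (t (i + k)%N - t (i + j)%N) != 1 \/ be2 ^+ (t (i + k)%N - t (i + j)%N) != 1.
    by apply: t_dist; rewrite ltn_add2l jk (leq_trans _ iN) // leq_add2l -ltnS.
  + by rewrite E ?eqxx.
  + by rewrite E ?eqxx.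
have le1 l : (l < 8)%N -> hgt (X l) (Y l) 1 <= d%:R * eta.
  move=> l8; rewrite hgt_be ler_wpM2r // ler_nat /d leq_sub2r //.
  by apply: mono.
have ln_ge : 7^-1 <= ln (7 / 6) :> R.
  have := @le_ln1Dx R (- 7^-1); rewrite (_ : 1 + - 7^-1 = (7 / 6)^-1 :> R); last by field.
  by rewrite lnV ?posrE; lra.
have := le1 _ j8; have := le1 _ k8; lra.
Qed.

Let pade_step i j n : (0 < n)%N -> (i <= N)%N -> (j <= N)%N -> (2 * n * t i <= t j)%N ->
  n%:R * h (t i) <= n%:R * (4 * A) + (t j - 2 * n * t i)%:R * eta + n%:R * (11 * ln 2).
Proof.
move=> n0 iN jN le; set r := (t j - 2 * n * t i)%N.
have tjE : (t j = r + t i * (2 * n))%N by move: le; rewrite /r; clear; lia.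
have := @hgt_pade (a1 * be1 ^+ t i) (a2 * be2 ^+ t i) (-1) (a1 * be1 ^+ t j) (a2 * be2 ^+ t j) (-1) n n0.
move=> /(_ (And3 (c1_neq0 _) (c2_neq0 _) m1_neq0) (And3 (c1_neq0 _) (c2_neq0 _) m1_neq0)).
move=> /(_ (sol_sum iN) (sol_sum jN)) /le_trans; apply; rewrite lerD2r.
have E (a b : L) : a != 0 -> b != 0 ->
    a * b ^+ t j / (a * b ^+ t i) ^+ (2 * n) = (a * b ^+ 0)^-1 ^+ (2 * n - 1) * b ^+ r.
  move=> a0 b0; rewrite expr0 mulr1 tjE exprD exprM exprMn exprVn.
  have -> : a ^+ (2 * n) = a * a ^+ (2 * n - 1) by rewrite -exprS; congr (_ ^+ _); move: n0; clear; lia.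
  by field; rewrite !expf_neq0.
rewrite !E //.
have -> : -1 / (-1) ^+ (2 * n) = (-1)^-1 ^+ (2 * n - 1) * 1 :> L.
  rewrite mulr1 invrN1 [in LHS]exprM sqrrN !expr1n divr1 -signr_odd oddB; last by move: n0; clear; lia.
  by rewrite oddM /= expr1.
apply: le_trans (hgtM _ _ _ _ _ _) _; rewrite ?expf_neq0 ?invr_eq0 //.
rewrite hgt_be lerD2r hgtX ?invr_eq0 //.
have hV : hgt (a1 * be1 ^+ 0)^-1 (a2 * be2 ^+ 0)^-1 (-1)^-1 <= 2 * A by apply: hgtV.
apply: le_trans (ler_wpM2l _ hV) _; first exact: ler0n.
have -> : n%:R * (4 * A) = (2 * n)%:R * (2 * A) by rewrite natrM; ring.
by rewrite ler_wpM2r ?mulr_ge0 // ler_nat leq_subr.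
Qed.

Lemma one_sided : (N < 4150)%N.
Proof. exact: (@gap_principle_bound h eta t N). Qed.

End OneSided.

Lemma exists_min (f : nat -> R) M :
  exists2 i0, (i0 <= M)%N & forall i, (i <= M)%N -> f i0 <= f i.
Proof.
elim: M => [|M [i0 i0M Hi0]]; first by exists 0%N => // -[].
have [le|lt] := leP (f i0) (f M.+1).
  exists i0; first exact: leqW.
  by move=> i; rewrite leq_eqVlt => /orP [/eqP -> //|]; apply: Hi0.
exists M.+1 => // i; rewrite leq_eqVlt => /orP [/eqP -> //|iM].
exact: le_trans (ltW lt) (Hi0 _ iM).
Qed.

(** Minimality of the starting height is needed on both sides, so the origin is moved to
a solution of minimal height; the earlier ones follow it when the bases are inverted. *)
Lemma two_sided (a1 a2 be1 be2 : L) (t : nat -> nat) M :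
  a1 != 0 -> a2 != 0 -> be1 != 0 -> be2 != 0 ->
  (forall i j, (i < j <= M)%N -> (t i < t j)%N) ->
  (forall i, (i <= M)%N -> a1 * be1 ^+ t i + a2 * be2 ^+ t i = 1) ->
  (forall i j, (i < j <= M)%N ->
     be1 ^+ (t j - t i) != 1 \/ be2 ^+ (t j - t i) != 1) ->
  (M < 4150 + 4150)%N.
Proof.
move=> a10 a20 b10 b20 t_incr t_sol t_dist.
have mono i j : (i <= j)%N -> (j <= M)%N -> (t i <= t j)%N.
  by rewrite leq_eqVlt => /orP [/eqP -> //|ij] jM; apply/ltnW/t_incr; rewrite ij.
pose h k := hgt (a1 * be1 ^+ k) (a2 * be2 ^+ k) (-1).
have [i0 i0M Hmin] := exists_min (fun i => h (t i)) M.
have right_bound : (M - i0 < 4150)%N.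
  apply: (@one_sided (a1 * be1 ^+ t i0) (a2 * be2 ^+ t i0) be1 be2 _ _ _ _
     (fun i => t (i0 + i)%N - t i0)%N); rewrite ?mulf_neq0 ?expf_neq0 //.
  - by rewrite addn0 subnn.
  - move=> i j /andP [ij jM]; rewrite ltn_sub2rE; last by apply: mono; rewrite ?leq_addr //; lia.
    by apply: t_incr; rewrite ltn_add2l ij /=; lia.
  - move=> i iM; rewrite -!mulrA -!exprD subnKC; last by apply: mono; rewrite ?leq_addr //; lia.
    by apply: t_sol; lia.
  - move=> i j /andP [ij jM].
    rewrite subnBA; last by apply: mono; rewrite ?leq_addr //; lia.
    rewrite subnK; last by apply: mono; rewrite ?leq_addr //; lia.
    by apply: t_dist; rewrite ltn_add2l ij /=; lia.
  - move=> i iM; rewrite !expr0 !mulr1 -!mulrA -!exprD subnKC; last by apply: mono; rewrite ?leq_addr //; lia.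
    by apply: Hmin; lia.
have left_bound : (i0 < 4150)%N.
  have E (b : L) i : b != 0 -> (i <= i0)%N -> b ^+ t i0 * b^-1 ^+ (t i0 - t (i0 - i)%N) = b ^+ t (i0 - i)%N.
    move=> b0 ii0; have le : (t (i0 - i) <= t i0)%N by apply: mono => //; apply: leq_subr.
    rewrite -{1}(subnK le) exprD exprVn; field; exact: expf_neq0.
  have le0 i j : (i <= j)%N -> (t (i0 - j) <= t (i0 - i))%N.
    by move=> ij; apply: mono; lia.
  apply: (@one_sided (a1 * be1 ^+ t i0) (a2 * be2 ^+ t i0) be1^-1 be2^-1 _ _ _ _
     (fun i => t i0 - t (i0 - i)%N)%N); rewrite ?mulf_neq0 ?expf_neq0 ?invr_eq0 //.
  - by rewrite subn0 subnn.
  - move=> i j /andP [ij ji0]; have lt : (t (i0 - j) < t (i0 - i))%N by apply: t_incr; lia.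
    by have := le0 0%N i (leq0n _); rewrite subn0; lia.
  - move=> i ii0; rewrite -!mulrA !E //; apply: t_sol; lia.
  - move=> i j /andP [ij ji0].
    have -> : (t i0 - t (i0 - j) - (t i0 - t (i0 - i)) = t (i0 - i) - t (i0 - j))%N.
      by have := le0 0%N i (leq0n _); have := le0 0%N j (leq0n _); rewrite subn0; lia.
    by rewrite !exprVn !invr_eq1; apply: t_dist; lia.
  - move=> i ii0; rewrite !expr0 !mulr1 -!mulrA !E //.
    by apply: Hmin; lia.
by have := leq_add left_bound (ltnW right_bound); rewrite addSn subnKC.
Qed.

End Heights.

(** * Number fields and their embeddings *)

(** The field is generated by one element, which is sent to a root of its minimal
polynomial; any expression in the generator may then be used to evaluate. *)
Lemma embed_numfield (L : fieldExtType rat) (F : numClosedFieldType) :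
  inhabited {rmorphism L -> F}.
Proof.
have sep : separable 1 {:L}.
  by apply/separableP => y _; apply: pcharf0_separable; move=> p; rewrite pchar_lalg pchar_num.
have gen := eq_adjoin_separable_generator sep (sub1v _).
set th := separable_generator _ _ in gen.
pose ev (p : {poly rat}) : L := (map_poly (in_alg L) p).[th].
have repr x : exists p, ev p = x.
  have : x \in <<1; th>>%VS by rewrite -gen memvf.
  by case/Fadjoin_polyP => p /polyOver1P [q ->] ->; exists q.
have [pr prK] := choice repr.
have /polyOver1P [m Em] := minPolyOver 1 th.
have sm : (1 < size m)%N.
  by have := size_minPoly 1 th; rewrite Em size_map_poly => ->;
     rewrite ltnS adjoin_degreeE divn_gt0 ?adim_gt0 // dimvS // subv_adjoin.
have [z mz] : exists z : F, root (map_poly ratr m) z.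
  by apply/closed_rootP; rewrite size_map_poly neq_ltn sm orbT.
pose ez (p : {poly rat}) : F := (map_poly ratr p).[z].
have ev0 p : ev p = 0 -> ez p = 0.
  move=> p0; have : minPoly 1 th %| map_poly (in_alg L) p.
    by apply: minPoly_dvdp; [apply/polyOver1P; exists p|apply/eqP].
  rewrite Em dvdp_map => /dvdpP [q ->].
  by rewrite /ez rmorphM hornerM /=; move/rootP: mz => ->; rewrite mulr0.
have evB p q : ev (p - q) = ev p - ev q by rewrite /ev rmorphB hornerD hornerN.
have evM p q : ev (p * q) = ev p * ev q by rewrite /ev rmorphM hornerM.
have ezB p q : ez (p - q) = ez p - ez q by rewrite /ez rmorphB hornerD hornerN.
have ezM p q : ez (p * q) = ez p * ez q by rewrite /ez rmorphM hornerM.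
have ev_ez p q : ev p = ev q -> ez p = ez q.
  move=> e; apply/eqP; rewrite -subr_eq0 -ezB; apply/eqP; apply: ev0.
  by rewrite evB e subrr.
pose f x := ez (pr x).
have fB : zmod_morphism f.
  by move=> x y; rewrite /f -ezB; apply: ev_ez; rewrite evB !prK.
have fM : monoid_morphism f.
  split; last by move=> x y; rewrite /f -ezM; apply: ev_ez; rewrite evM !prK.
  have -> : 1 = ez 1 by rewrite /ez rmorph1 hornerC.
  by apply: ev_ez; rewrite prK /ev rmorph1 hornerC.
pose fBm := GRing.isZmodMorphism.Build L F f fB.
pose fMm := GRing.isMonoidMorphism.Build L F f fM.
by constructor; exact: (HB.pack f fBm fMm : {rmorphism L -> F}).
Qed.

Lemma galois_numfield (s : seq algC) :
  exists (L : splittingFieldType rat) (f : {rmorphism L -> algC}),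
    galois 1 {:L} /\ forall x, x \in s -> exists y, f y = x.
Proof.
have [P [P0 HP]] : exists P : {poly rat}, P != 0 /\
    forall x, x \in s -> root (map_poly ratr P) x.
  elim: s => [|x s [P [P0 HP]]]; first by exists 1; rewrite oner_neq0.
  have [r [Dr mon_r] dv_r] := minCpolyP x.
  exists (r * P); split; first by rewrite mulf_neq0 ?(monic_neq0 mon_r).
  move=> y; rewrite inE rmorphM /= rootM => /orP [/eqP ->|/HP ->]; last by rewrite orbT.
  by rewrite -Dr root_minCpoly.
have [r Er] := closed_field_poly_normal (map_poly ratr P : {poly algC}).
have [Qs [QsC [r1 Hr1 gen]]] := num_field_exists r.
have PE : map_poly QsC (map_poly (in_alg Qs) P) = map_poly ratr P.
  by rewrite -map_poly_comp; apply: eq_map_poly => a /=; rewrite alg_num_field fmorph_rat.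
have lc0 : lead_coef (map_poly (ratr : rat -> algC) P) != 0 by rewrite lead_coef_eq0 map_poly_eq0.
have splitP : splittingFieldFor 1 (map_poly (in_alg Qs) P) {:Qs}.
  exists r1 => //; rewrite -(eqp_map QsC) PE Er -Hr1 big_map rmorph_prod /=.
  by rewrite (eq_bigr _ (fun y _ => map_polyXsubC QsC y)) eqp_scale.
have Qs_ax : FieldExt_isSplittingField _ Qs.
  by constructor; exists (map_poly (in_alg Qs) P) => //; apply/polyOver1P; exists P.
pose L : splittingFieldType rat := HB.pack Qs Qs_ax.
exists L, QsC; split.
  apply/and3P; split; [exact: sub1v| |exact: normalFieldf].
  by apply/separableP => y _; apply: pcharf0_separable => p; rewrite pchar_lalg pchar_num.
move=> x /HP; rewrite Er rootZ // root_prod_XsubC -Hr1 => /mapP [y _ ->].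
by exists y.
Qed.

(** One embedding of a Galois closure, composed with its automorphisms. *)
Lemma numfield_embeddings (R : realType) (s : seq algC) :
  exists (L : fieldType) (I : finType) (sg : I -> {rmorphism L -> R[i]})
      (f : {rmorphism L -> algC}),
    [/\ (0 < #|I|)%N, (forall x, exists q : rat, \prod_i sg i x = ratr q),
      (forall i x, algebraicOver (ratr : rat -> R[i]) (sg i x))
    & forall x, x \in s -> exists y, f y = x].
Proof.
have [L [f [gal Hf]]] := galois_numfield s.
have [io] := embed_numfield L R[i].
exists L, (gal_of {:L}),
  (fun g : gal_of {:L} => (io \o (gal_repr g : L -> L))%FUN : {rmorphism L -> R[i]}), f; split=> //.
- by apply/card_gt0P; exists 1%g.
- move=> x; have /vlineP [q Hq] := mem_galNorm gal (memvf x).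
  exists q; rewrite -rmorph_prod /=.
  have -> : \prod_(g : gal_of {:L}) (g : L -> L) x = galNorm 1 {:L} x.
    apply: eq_bigl => g; rewrite gal_kHom ?sub1v //; apply/esym/kAHomP => _ /vlineP [k ->].
    by rewrite linearZ /= rmorph1.
  by rewrite Hq rmorphZ_num rmorph1 mulr1.
- move=> g x /=; set y := g x.
  have /polyOver1P [m Em] := minPolyOver 1 y.
  exists m.
    rewrite -(map_poly_eq0 (in_alg L)) -Em; exact: monic_neq0 (monic_minPoly _ _).
  have -> : map_poly ratr m = map_poly io (map_poly (in_alg L) m).
    by rewrite -map_poly_comp; apply: eq_map_poly => a /=; rewrite alg_num_field fmorph_rat.
  by rewrite -Em fmorph_root root_minPoly.
Qed.

(** * Specialization to algebraic numbers *)

Section Specialization.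
Variables (C : fieldType) (K : closedFieldType).

(** The ring A need not be embedded in C: only the relations holding in the
image of i have to be respected. *)
Definition specializes (A : idomainType) (i : {rmorphism A -> C}) :=
  forall b, i b != 0 -> exists phi : {rmorphism A -> K},
    (forall y, i y = 0 -> phi y = 0) /\ phi b != 0.

Section Step.
Variables (A : idomainType) (i : {rmorphism A -> C}) (x : C).
Implicit Types P Q m r : {poly A}.

Let im P : {poly C} := map_poly i P.
Let ev P : C := (im P).[x].

Let imD P Q : im (P + Q) = im P + im Q. Proof. exact: rmorphD. Qed.
Let imB P Q : im (P - Q) = im P - im Q. Proof. exact: rmorphB. Qed.
Let imM P Q : im (P * Q) = im P * im Q. Proof. exact: rmorphM. Qed.
Let imZ c P : im (c *: P) = i c *: im P. Proof. exact: map_polyZ. Qed.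
Let im_lead m : i (lead_coef m) != 0 -> size (im m) = size m.
Proof. exact: size_poly_eq. Qed.

(** Truncating a polynomial to the size of its image keeps it in S, so a minimal one has
a leading coefficient which survives in C and can be used for pseudo-division. *)
Let minimal (S : {poly C} -> Prop) : (exists2 m, S (im m) & im m != 0) ->
  exists m, [/\ S (im m), i (lead_coef m) != 0 &
    forall r, S (im r) -> (size (im r) < size m)%N -> im r = 0].
Proof.
move=> [m0 Sm0 m0n].
have ex : exists n, `[< exists2 m, S (im m) & im m != 0 /\ size (im m) = n >].
  by exists (size (im m0)); apply/asboolP; exists m0.
case: (ex_minnP ex) => n /asboolP [m Sm [mn sm]] nmin.
pose m' := take_poly n m.
have Em : im m' = im m.
  apply/polyP => k; rewrite !coef_map coef_take_poly; case: ltnP => // nk.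
  by rewrite raddf0 -coef_map nth_default // sm.
have n0 : (0 < n)%N by rewrite -sm lt0n size_poly_eq0.
have top : i m'`_n.-1 != 0.
  by rewrite -coef_map -/(im m') Em -sm -lead_coefE lead_coef_eq0.
have sm' : size m' = n.
  apply/eqP; rewrite eqn_leq size_take_poly /= leqNgt; apply/negP => lt.
  by move/eqP: top; apply; rewrite nth_default ?raddf0 // -ltnS prednK.
exists m'; rewrite Em lead_coefE sm'; split=> // r Sr lt.
apply/eqP; apply: contraLR lt => rn; rewrite -leqNgt.
by apply: nmin; apply/asboolP; exists r.
Qed.

(** A transcendental x is sent to a value that is not a root of the specialized B.  If x is
algebraic, let m be a relation of minimal degree; an ideal argument gives u, v and a
constant rho != 0 with rho = u m + v B over C, and x is sent to any root of the
specialized m provided that the leading coefficient of m and rho stay nonzero. *)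
Lemma specializes_step : specializes i ->
  specializes ((horner_eval x \o map_poly i)%FUN : {rmorphism {poly A} -> C}).
Proof.
move=> Hi B; rewrite /= /horner_eval -/(ev B) => B0.
have [[m0 m0x m0n]|trans] := pselect (exists2 m, ev m = 0 & im m != 0); last first.
  have imB0 : im B != 0 by apply: contra_neq B0; rewrite /ev => ->; rewrite horner0.
  have [|phi [phi0 phiB]] := Hi (B`_(size (im B)).-1).
    by rewrite -coef_map -/(im B) -lead_coefE lead_coef_eq0.
  have Bn : map_poly phi B != 0.
    apply: contra_neq phiB => e; rewrite -coef_map /=.
    by move: e => ->; rewrite coef0.
  have [xi Hxi] := closed_nonrootP _ Bn.
  exists ((horner_eval xi \o map_poly phi)%FUN); split=> //.
  move=> P /= ; rewrite /horner_eval -/(ev P) => P0.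
  have imP : im P = 0 by apply: contrapT => /eqP ne; apply: trans; exists P.
  have -> : map_poly phi P = 0.
    apply/polyP => k; rewrite coef_map coef0; apply: phi0.
    by rewrite -coef_map -/(im P) imP coef0.
  by rewrite horner0.
have [|m [mx lm mmin]] := @minimal (fun U : {poly C} => U.[x] = 0); first by exists m0.
have mn : m != 0 by apply: contra_neq lm => ->; rewrite lead_coef0 rmorph0.
have lmX k : i (lead_coef m ^+ k) != 0 by rewrite rmorphXn expf_neq0.
pose S (Q : {poly C}) := exists u v, Q = im (u * m + v * B).
have [|r [[u [v Er]] lr rmin]] := @minimal S.
  by exists m; [exists 1, 0; rewrite mul1r mul0r addr0|rewrite -size_poly_eq0 im_lead ?size_poly_eq0].
have rn : r != 0 by apply: contra_neq lr => ->; rewrite lead_coef0 rmorph0.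
have rdiv Q : S (im Q) -> exists c q, i c != 0 /\ im (c *: Q) = im q * im r.
  move=> [u' [v' EQ]]; exists (lead_coef r ^+ Pdiv.Idomain.scalp Q r), (Q %/ r).
  split; first by rewrite rmorphXn expf_neq0.
  rewrite Pdiv.Idomain.divp_eq imD imM [im (Q %% r)]rmin ?addr0 //.
    set c := lead_coef r ^+ Pdiv.Idomain.scalp Q r.
    have -> : Q %% r = c *: Q - Q %/ r * r.
      by rewrite Pdiv.Idomain.divp_eq addrC addKr.
    exists (c *: u' - Q %/ r * u), (c *: v' - Q %/ r * v).
    rewrite imB imZ imM EQ Er -imZ -imM -imB; congr im.
    by rewrite -!mul_polyC; ring.
  by apply: leq_ltn_trans (size_poly _ _) _; rewrite Pdiv.Idomain.ltn_modp.
have [c [q [c0 Eq]]] : exists c q, i c != 0 /\ im (c *: m) = im q * im r.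
  by apply: rdiv; exists 1, 0; rewrite mul1r mul0r addr0.
have [c' [q' [c'0 Eq']]] : exists c q, i c != 0 /\ im (c *: B) = im q * im r.
  by apply: rdiv; exists 0, 1; rewrite mul1r mul0r add0r.
have rx : ev r != 0.
  apply: contra_neq B0 => r0; apply: (mulfI c'0).
  by rewrite /ev -hornerZ -imZ Eq' hornerM -/(ev r) r0 !mulr0.
have qx : ev q = 0.
  apply: (mulIf rx); rewrite /ev -hornerM -Eq imZ hornerZ mx mul0r.
  by rewrite mulr0.
have imr : im r != 0 by rewrite -size_poly_eq0 im_lead ?size_poly_eq0.
have imm : im m != 0 by rewrite -size_poly_eq0 im_lead ?size_poly_eq0.
have qn : im q != 0.
  apply: contra_neq imm => q0; apply/eqP.
  by move/eqP: Eq; rewrite q0 mul0r imZ scaler_eq0 (negPf c0).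
have r1 : (size r <= 1)%N.
  rewrite leqNgt; apply/negP => r2; move/eqP: (qn); apply; apply: mmin => //.
  have Esz : size (im m) = (size (im q) + size (im r)).-1.
    have e : size (im q * im r) = size (im m) by rewrite -Eq imZ size_scale.
    by rewrite -e (size_mul qn imr).
  rewrite -(im_lead lm) Esz (im_lead lr).
  by move: (size (im q)) (size r) r2 => a b; case: b => [|[|b]] // _; rewrite !addnS /= ltnS leq_addr.
have [rho Erho] : exists rho, r = rho%:P by exists r`_0; apply: size1_polyC.
have irho : i rho != 0 by move: lr; rewrite Erho lead_coefC.
have [|phi [phi0 phia]] := Hi (lead_coef m * rho); first by rewrite rmorphM mulf_neq0.
move: phia; rewrite rmorphM mulf_eq0 negb_or => /andP [phim phir].
have phi_im P : im P = 0 -> map_poly phi P = 0.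
  move=> P0; apply/polyP => k; rewrite coef_map coef0; apply: phi0.
  by rewrite -coef_map -/(im P) P0 coef0.
have sm : size (map_poly phi m) = size m by apply: size_poly_eq.
have m2 : (1 < size m)%N.
  rewrite ltnNge; apply/negP => /size1_polyC e; move: mx lm.
  by rewrite e /im map_polyC /= hornerC lead_coefC => ->; rewrite eqxx.
have [xi Hxi] : exists xi, root (map_poly phi m) xi.
  by apply/closed_rootP; rewrite sm neq_ltn m2 orbT.
exists ((horner_eval xi \o map_poly phi)%FUN); rewrite /= /horner_eval; split.
  move=> P P0; have E := Pdiv.Idomain.divp_eq P m.
  have R0 : im (P %% m) = 0.
    apply: mmin; last by apply: leq_ltn_trans (size_poly _ _) _; rewrite Pdiv.Idomain.ltn_modp.
    have := congr1 ev E; rewrite /ev imD imM imZ hornerZ hornerD hornerM mx mulr0 add0r.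
    by move=> <-; rewrite [_.[x]]P0 mulr0.
  have := congr1 (fun Q => (map_poly phi Q).[xi]) E.
  rewrite map_polyZ rmorphD rmorphM /= (phi_im _ R0) addr0 hornerZ hornerM (rootP Hxi) mulr0 => /eqP.
  by rewrite mulf_eq0 rmorphXn expf_eq0 (negPf phim) andbF => /eqP.
have : im (r - (u * m + v * B)) = 0 by rewrite imB Er subrr.
move/phi_im/(congr1 (horner_eval xi)); rewrite /horner_eval Erho.
rewrite rmorphB rmorphD !rmorphM /= map_polyC !hornerE (rootP Hxi) mulr0 add0r /= => /eqP.
rewrite subr_eq0 => /eqP e; apply: contra_neq phir => B00.
by rewrite e B00 mulr0.
Qed.

End Step.
End Specialization.

Lemma specializes_fg (C : numClosedFieldType) (s : seq C) :
  exists (A : idomainType) (i : {rmorphism A -> C}),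
    (forall x, x \in s -> exists a, i a = x) /\ specializes algC i.
Proof.
elim: s => [|x s [A [i [Hs Hi]]]].
  exists int, intr; split=> // b b0; exists intr; split.
    by move=> y /eqP; rewrite intr_eq0 => /eqP ->.
  by rewrite intr_eq0 -(intr_eq0 C).
exists {poly A}, (horner_eval x \o map_poly i)%FUN; split; last exact: specializes_step.
move=> y; rewrite inE => /orP [/eqP ->|/Hs [a <-]].
  by exists 'X; rewrite /= map_polyX /horner_eval hornerX.
by exists a%:P; rewrite /= map_polyC /horner_eval hornerC.
Qed.

(** * The unit equation over the complex numbers *)

(** The differences that keep the solutions distinct are finitely many, so their product
can be kept nonzero by the specialization. *)
Lemma unit_equation_nat (R : realType) (C : numClosedFieldType) (a1 a2 be1 be2 : C)
    (t : nat -> nat) M :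
  a1 != 0 -> a2 != 0 -> be1 != 0 -> be2 != 0 ->
  (forall i j, (i < j <= M)%N -> (t i < t j)%N) ->
  (forall i, (i <= M)%N -> a1 * be1 ^+ t i + a2 * be2 ^+ t i = 1) ->
  (forall i j, (i < j <= M)%N ->
     be1 ^+ (t j - t i) != 1 \/ be2 ^+ (t j - t i) != 1) ->
  (M < 4150 + 4150)%N.
Proof.
move=> a10 a20 b10 b20 t_incr t_sol t_dist.
have [A [io [Hio spec]]] := specializes_fg [:: a1; a2; be1; be2].
have [xa1 Ea1] : exists a, io a = a1 by apply: Hio; rewrite !inE eqxx ?orbT.
have [xa2 Ea2] : exists a, io a = a2 by apply: Hio; rewrite !inE eqxx ?orbT.
have [xb1 Eb1] : exists a, io a = be1 by apply: Hio; rewrite !inE eqxx ?orbT.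
have [xb2 Eb2] : exists a, io a = be2 by apply: Hio; rewrite !inE eqxx ?orbT.
pose d k := if be1 ^+ k != 1 then xb1 ^+ k - 1 else xb2 ^+ k - 1.
pose B := xa1 * xa2 * xb1 * xb2 *
  \prod_(i < M.+1) \prod_(j < M.+1 | (i < j)%N) d (t j - t i)%N.
have [|phi [phi0 phiB]] := spec B.
  rewrite /B !rmorphM Ea1 Ea2 Eb1 Eb2 !mulf_neq0 // rmorph_prod.
  apply/prodf_neq0 => i _; rewrite rmorph_prod; apply/prodf_neq0 => j ij.
  rewrite /d; case: ifP => [ne|/negbFE/eqP e].
    by rewrite rmorphB rmorphXn rmorph1 /= Eb1 subr_eq0.
  rewrite rmorphB rmorphXn rmorph1 /= Eb2 subr_eq0.
  case: (t_dist i j) => //; last by rewrite e eqxx.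
  by rewrite ij -ltnS /=.
move: phiB; rewrite /B !rmorphM !mulf_eq0 !negb_or -!andbA => /and5P[ya10 ya20 yb10 yb20 ydn].
have [L [I [sg [f [I0 normq alg Hf]]]]] :=
  numfield_embeddings R [:: phi xa1; phi xa2; phi xb1; phi xb2].
have [za1 Fa1] : exists a, f a = phi xa1 by apply: Hf; rewrite !inE eqxx ?orbT.
have [za2 Fa2] : exists a, f a = phi xa2 by apply: Hf; rewrite !inE eqxx ?orbT.
have [zb1 Fb1] : exists a, f a = phi xb1 by apply: Hf; rewrite !inE eqxx ?orbT.
have [zb2 Fb2] : exists a, f a = phi xb2 by apply: Hf; rewrite !inE eqxx ?orbT.
apply: (two_sided I0 normq alg (a1 := za1) (a2 := za2) (be1 := zb1) (be2 := zb2) (t := t)) => //.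
- by rewrite -(fmorph_eq0 f) Fa1.
- by rewrite -(fmorph_eq0 f) Fa2.
- by rewrite -(fmorph_eq0 f) Fb1.
- by rewrite -(fmorph_eq0 f) Fb2.
- move=> i iM; apply: (fmorph_inj f); rewrite rmorphD !rmorphM !rmorphXn rmorph1 /=.
  rewrite Fa1 Fa2 Fb1 Fb2; apply/eqP; rewrite -subr_eq0; apply/eqP.
  have := phi0 (xa1 * xb1 ^+ t i + xa2 * xb2 ^+ t i - 1).
  rewrite !(rmorphB, rmorphD, rmorphM, rmorphXn, rmorph1) /= Ea1 Ea2 Eb1 Eb2 t_sol // subrr.
  by apply.
- move=> i j /andP [ij jM].
  have iM1 : (i < M.+1)%N by rewrite ltnS (leq_trans (ltnW ij)).
  have jM1 : (j < M.+1)%N by rewrite ltnS.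
  move: ydn; rewrite rmorph_prod => /prodf_neq0 /(_ (Ordinal iM1) isT).
  rewrite rmorph_prod => /prodf_neq0 /(_ (Ordinal jM1) ij) /=.
  by rewrite /d; case: ifP => _; rewrite rmorphB rmorphXn rmorph1 /= subr_eq0;
    [rewrite -Fb1|rewrite -Fb2]; rewrite -rmorphXn -(rmorph1 f) (inj_eq (fmorph_inj f)); auto.
Qed.

Lemma unit_equation_int (R : realType) (C : numClosedFieldType) (a b be ga : C) (s : seq int) :
  a != 0 -> b != 0 -> be != 0 -> ga != 0 ->
  ~ is_root_of_unity be \/ ~ is_root_of_unity ga ->
  uniq s -> (forall m, m \in s -> a * be ^ m + b * ga ^ m = 1) ->
  (size s <= 4150 + 4150)%N.
Proof.
move=> a0 b0 be0 ga0 nru us sol.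
rewrite leqNgt; apply/negP => big.
pose s' := sort <=%O s.
have ss' : sorted <%O s' by rewrite sort_lt_sorted.
have sz : size s' = size s by rewrite size_sort.
pose n i := nth 0 s' i.
have n_lt i j : (i < j < size s)%N -> n i < n j.
  move=> /andP [ij js]; apply: (sorted_ltn_nth lt_trans) => //; rewrite inE sz //.
  exact: ltn_trans js.
have n_mem i : (i < size s)%N -> n i \in s.
  by move=> h; rewrite -(mem_sort <=%O) mem_nth // sz.
have n0_le i : (i < size s)%N -> n 0%N <= n i.
  by case: i => [|i] h; [exact: lexx|apply/ltW/n_lt].
pose t i := `|n i - n 0%N|%N.
have tE i : (i < size s)%N -> (t i)%:Z = n i - n 0%N.
  by move=> h; rewrite /t gez0_abs // subr_ge0 n0_le.
pose M := (size s).-1.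
have Ms : size s = M.+1 by rewrite /M prednK // (leq_trans _ big).
have tM i j : (i < j <= M)%N -> (t i < t j)%N.
  move=> /andP [ij jM]; rewrite -ltz_nat !tE ?Ms ?ltnS ?(leq_trans (ltnW ij)) //.
  by rewrite ltrD2r n_lt // ij Ms ltnS.
have : (M < 4150 + 4150)%N.
  apply: (@unit_equation_nat R C (a * be ^ n 0%N) (b * ga ^ n 0%N) be ga t M) => //.
  - by rewrite mulf_neq0 // expfz_neq0.
  - by rewrite mulf_neq0 // expfz_neq0.
  - move=> i iM; have iS : (i < size s)%N by rewrite Ms ltnS.
    rewrite -!mulrA !exprnP tE // -!expfzDr //.
    have -> : n 0%N + (n i - n 0%N) = n i by rewrite addrC subrK.
    by apply/sol/n_mem.
  - move=> i j ij; have tij := tM _ _ ij; have k0 : (0 < t j - t i)%N by rewrite subn_gt0.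
    case: nru => nru; [left|right]; apply/eqP => e; apply: nru;
      by exists (t j - t i)%N => //; apply/unity_rootP.
by rewrite -ltnS -Ms ltnNge big.
Qed.

(** * Quadratics against exponentials *)

Section ThreeZeros.
Variable R : realType.

Lemma rolle_zero (f g : R -> R) (x y : R) : x < y ->
  (forall z : R, is_derive z 1 f (g z)) -> f x = 0 -> f y = 0 ->
  exists2 z, x < z < y & g z = 0.
Proof.
move=> xy df fx fy.
have [z||z zxy dz] := Rolle xy _ _ (etrans fx (esym fy)).
- by move=> _; have [] := df z.
- by apply: derivable_within_continuous => z _; have [] := df z.
exists z; first by move: zxy; rewrite in_itv.
by have [_ <-] := df z; have [_ <-] := dz.
Qed.

Let ef (a l : R) (P : {poly R}) (x : R) := a * expR (l * x) - P.[x].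

Let ef_derive a l P (z : R) : is_derive z 1 (ef a l P) (ef (a * l) l P^`() z).
Proof.
have d1 : is_derive z 1 (fun x : R => l * x) (l * 1) := is_deriveZ l (is_derive_id z 1).
have d2 := is_derive1_comp (is_derive_expR (l * z)) d1.
have d3 := is_deriveZ a d2.
have d4 := is_derive_poly P z.
have d5 := is_deriveB d3 d4.
apply: (is_derive_eq d5).
by rewrite /ef /GRing.scale /=; ring.
Qed.

(** Four zeros of the difference give, by Rolle, a zero of the second derivative and one
of the third, which is a l ^ 3 e ^ (l x); so a l = 0, and the second derivative is a
nonzero constant. *)
Lemma quadratic_exponential (a l : R) (P : {poly R}) (x1 x2 x3 x4 : R) :
  (size P <= 3)%N -> P`_2 != 0 -> x1 < x2 -> x2 < x3 -> x3 < x4 ->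
  (forall x, x \in [:: x1; x2; x3; x4] -> a * expR (l * x) = P.[x]) -> False.
Proof.
move=> sP P2 l12 l23 l34 H.
have z0 x : x \in [:: x1; x2; x3; x4] -> ef a l P x = 0.
  by move=> /H; rewrite /ef => ->; rewrite subrr.
have [Z1 Z2 Z3 Z4] : [/\ ef a l P x1 = 0, ef a l P x2 = 0, ef a l P x3 = 0 & ef a l P x4 = 0].
  by split; apply: z0; rewrite !inE eqxx ?orbT.
have [y1 /andP [y1l y1r] g1] := rolle_zero l12 (ef_derive a l P) Z1 Z2.
have [y2 /andP [y2l y2r] g2] := rolle_zero l23 (ef_derive a l P) Z2 Z3.
have [y3 /andP [y3l y3r] g3] := rolle_zero l34 (ef_derive a l P) Z3 Z4.
have [w1 /andP [w1l w1r] h1] := rolle_zero (lt_trans y1r y2l) (ef_derive _ l _) g1 g2.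
have [w2 /andP [w2l w2r] h2] := rolle_zero (lt_trans y2r y3l) (ef_derive _ l _) g2 g3.
have [v _ k1] := rolle_zero (lt_trans w1r w2l) (ef_derive _ l _) h1 h2.
have PE x : P^`()^`().[x] = P`_2 *+ 2.
  have -> : P^`()^`() = (P`_2 *+ 2)%:P.
    apply/polyP => k; rewrite coefC !coef_deriv; case: k => [|k] /=; first by rewrite mulr1n.
    by rewrite nth_default ?mul0rn // (leq_trans sP).
  by rewrite hornerC.
have P3 : P^`()^`()^`() = 0.
  apply/polyP => k; rewrite coef0 !coef_deriv nth_default ?mul0rn //.
  by rewrite (leq_trans sP).
move: k1; rewrite /ef P3 horner0 subr0 => /eqP; rewrite mulf_eq0 expR_eq0 orbF.
rewrite -mulrA mulf_eq0 => /orP [/eqP al|].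
  by move: h1; rewrite /ef al !mul0r PE sub0r => /eqP; rewrite oppr_eq0 mulrn_eq0 (negPf P2).
rewrite mulf_eq0 orbb => /eqP l0.
by move: h1; rewrite /ef l0 !(mulr0, mul0r) PE sub0r => /eqP; rewrite oppr_eq0 mulrn_eq0 (negPf P2).
Qed.

End ThreeZeros.

Lemma cabs_sqr (R : realType) (z : R[i]) : cabs z ^+ 2 = complex.Re z ^+ 2 + complex.Im z ^+ 2.
Proof. by rewrite /cabs normc_def /= sqr_sqrtr // addr_ge0 ?sqr_ge0. Qed.

Lemma cabs_exprz (R : realType) (g : R[i]) (m : int) : g != 0 ->
  cabs (g ^ m) = expR (ln (cabs g) * m%:~R).
Proof.
move=> g0; have cg : 0 < cabs g by rewrite cabs_gt0.
case: m => n; first by rewrite -exprnP cabsX -[X in _ * X]/(n%:R) expRM_natr lnK.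
rewrite NegzE -exprnN; apply: (mulIf (x := cabs (g ^+ n.+1))).
  by rewrite gt_eqF // cabs_gt0 expf_neq0.
rewrite -cabsM mulVf ?expf_neq0 // cabs1 cabsX.
rewrite -[X in _ * X ^+ _](@lnK _ (cabs g)) ?posrE // -expRM_natr -expRD.
rewrite rmorphN /= -[n.+1%:~R]/(n.+1%:R) -mulrDr addNr mulr0 expR0 //.
Qed.

(** Taking squares of absolute values removes the arguments of the complex numbers. *)
Lemma linear_exponential (R : realType) (a b c g : R[i]) (s : seq int) :
  b != 0 -> g != 0 -> uniq s ->
  (forall m, m \in s -> (a + b * m%:~R) * g ^ m = c) -> (size s <= 3)%N.
Proof.
move=> b0 g0 us sol; rewrite leqNgt; apply/negP => big.
pose s' := sort <=%O s.
have ss' : sorted <%O s' by rewrite sort_lt_sorted.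
have sz : size s' = size s by rewrite size_sort.
pose n i := nth 0 s' i.
have n_lt i j : (i < j < 4)%N -> n i < n j.
  move=> /andP [ij js]; apply: (sorted_ltn_nth lt_trans) => //; rewrite inE sz.
    by apply: leq_trans big; apply: ltn_trans js.
  exact: leq_trans big.
have n_mem i : (i < 4)%N -> n i \in s.
  by move=> h; rewrite -(mem_sort <=%O) mem_nth // sz (leq_trans h).
pose q := (complex.Re a * complex.Re b + complex.Im a * complex.Im b) *+ 2.
pose P : {poly R} := Poly [:: cabs a ^+ 2; q; cabs b ^+ 2].
apply: (@quadratic_exponential R (cabs c ^+ 2) (- (ln (cabs g) *+ 2)) P
   (n 0%N)%:~R (n 1%N)%:~R (n 2%N)%:~R (n 3%N)%:~R).
- exact: size_Poly.
- by rewrite coef_Poly /= expf_neq0 // gt_eqF // cabs_gt0.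
- by rewrite ltr_int n_lt.
- by rewrite ltr_int n_lt.
- by rewrite ltr_int n_lt.
have E m : m \in s -> cabs c ^+ 2 * expR (- (ln (cabs g) *+ 2) * m%:~R) = P.[m%:~R].
  move=> /sol Em; rewrite horner_Poly /=.
  have -> : ((0 * m%:~R + cabs b ^+ 2) * m%:~R + q) * m%:~R + cabs a ^+ 2
       = cabs (a + b * m%:~R) ^+ 2.
    rewrite !cabs_sqr -(rmorph_int (real_complex R)) /= /q.
    by case: (a) (b) => a1 a2 [b1 b2] /=; rewrite !mulr0 subr0 add0r; ring.
  have e : expR (ln (cabs g) * m%:~R) ^+ 2 * expR (- (ln (cabs g) *+ 2) * m%:~R) = 1.
    rewrite -expRM_natr -expRD -[RHS](expR0 R); congr expR.
    by rewrite -mulr_natr; ring.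
  by rewrite -Em cabsM exprMn cabs_exprz // -[LHS]mulrA e mulr1.
by move=> x; rewrite !inE => /or4P [] /eqP ->; apply: E; apply: n_mem.
Qed.

(** * Linear recurrences *)

Lemma counting_le (R : realType) (A : set int) (N : nat) :
  (forall s : seq int, uniq s -> (forall m, m \in s -> A m) -> (size s <= N)%N) ->
  (counting A <= N%:R%:E :> \bar R)%E.
Proof.
move=> H; rewrite /counting; case: asboolP => [finA|infA].
  rewrite lee_fin ler_nat; apply: H; first exact: finmap.fset_uniq.
  by move=> m; rewrite in_fset_set // inE.
have [B BA] := infinite_set_fset N.+1 infA.
rewrite ltnNge H //; exact: finmap.fset_uniq.
Qed.

Lemma int_step (P : int -> Prop) : P 0 -> (forall n, P n <-> P (n + 1)) -> forall n, P n.
Proof.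
move=> P0 PS; elim/int_ind => // n IH.
  have -> : n.+1%:Z = n%:Z + 1 by rewrite -addn1 PoszD.
  by case: (PS n) => H _; apply: H.
case: (PS (- n.+1%:Z)) => _; apply.
by have -> : - n.+1%:Z + 1 = - n%:Z by rewrite -addn1 PoszD opprD subrK.
Qed.

Section Recurrences.
Variable F : numClosedFieldType.
Implicit Types (u v : int -> F) (al be ga : F).

(** A recurrence with characteristic roots al, be, ... is the vanishing of
[shift al (shift be ...) u]. *)
Definition shift be u n := u (n + 1) - be * u n.

Lemma shiftC al be u n : shift al (shift be u) n = shift be (shift al u) n.
Proof. by rewrite /shift; ring. Qed.

Lemma eq_shift be u v : u =1 v -> shift be u =1 shift be v.
Proof. by move=> e n; rewrite /shift !e. Qed.

Lemma shift_sub al be u n : shift be u n - shift al u n = (al - be) * u n.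
Proof. by rewrite /shift; ring. Qed.

Lemma geometric al u : al != 0 -> (forall n, shift al u n = 0) ->
  forall n, u n = u 0 * al ^ n.
Proof.
move=> al0 H; apply: int_step; first by rewrite expr0z mulr1.
move=> n; have /eqP := H n; rewrite /shift subr_eq0 => /eqP ->.
rewrite expfzDr // expr1z mulrA [u 0 * _ * al]mulrC; split=> [-> //|].
exact: mulfI.
Qed.

Lemma linear_geometric al d u : al != 0 -> (forall n, shift al u n = d * al ^ n) ->
  forall n, u n = (u 0 + d / al * n%:~R) * al ^ n.
Proof.
move=> al0 H; apply: int_step; first by rewrite expr0z mulr0z mulr0 addr0 mulr1.
move=> n; have /eqP := H n; rewrite /shift subr_eq => /eqP ->.
have E : (u 0 + d / al * (n + 1)%:~R) * al ^ (n + 1) =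
    d * al ^ n + al * ((u 0 + d / al * n%:~R) * al ^ n).
  by rewrite expfzDr // expr1z intrD; field.
rewrite E; split=> [-> //|/addrI]; exact: mulfI.
Qed.

Lemma quadratic_geometric al y0 d u : al != 0 ->
  (forall n, shift al u n = (y0 + d * n%:~R) * al ^ n) ->
  forall n, u n = (u 0 + y0 / al * n%:~R + d / al * (n%:~R * (n%:~R - 1) / 2)) * al ^ n.
Proof.
move=> al0 H; apply: int_step.
  by rewrite expr0z mulr0z !(mulr0, mul0r, addr0, mulr1).
move=> n; have /eqP := H n; rewrite /shift subr_eq => /eqP ->.
have E : (u 0 + y0 / al * (n + 1)%:~R + d / al * ((n + 1)%:~R * ((n + 1)%:~R - 1) / 2)) * al ^ (n + 1) =
    (y0 + d * n%:~R) * al ^ n +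
    al * ((u 0 + y0 / al * n%:~R + d / al * (n%:~R * (n%:~R - 1) / 2)) * al ^ n).
  rewrite expfzDr // expr1z intrD; by field; rewrite ?al0 ?(pnatr_eq0 F 2).
rewrite E; split=> [-> //|/addrI]; exact: mulfI.
Qed.

Lemma order2_shift u be : has_order 2 u -> ~ (forall n, shift be u n = 0).
Proof.
move=> [_ H] E; apply: (H 1%N (fun=> be)) => // n.
by rewrite big_ord1 addr0; apply/eqP; rewrite -subr_eq0; apply/eqP/E.
Qed.

Lemma order3_shift u be ga : has_order 3 u -> ~ (forall n, shift be (shift ga u) n = 0).
Proof.
move=> [_ H] E; apply: (H 2%N (fun i => if i == 0 :> nat then - (be * ga) else be + ga)) => // n.
rewrite big_ord_recl big_ord1 /= addr0; apply/eqP; rewrite -subr_eq0; apply/eqP.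
by rewrite -(E n) /shift -[n + 1 + 1]addrA; ring.
Qed.

Lemma zero_ratio (z c : F) (s : seq int) : z != 0 -> ~ is_root_of_unity z -> uniq s ->
  (forall m, m \in s -> z ^ m = c) -> (size s <= 1)%N.
Proof.
move=> z0 nru; case: s => [|m [|m' s]] //= /andP [+ _] H.
rewrite inE negb_or => /andP [mm' _]; case: nru.
have e : z ^ (m - m') = 1.
  have -> : z ^ (m - m') = z ^ m / z ^ m' by rewrite expfzDr // invr_expz.
  by rewrite !H ?inE ?eqxx ?orbT // divff // -(H m) ?inE ?eqxx // expfz_neq0.
exists `|m - m'|%N; first by rewrite absz_gt0 subr_eq0.
apply/unity_rootP; move: e; case: (m - m') => k.
  by rewrite -exprnP.
by rewrite NegzE -exprnN => /eqP; rewrite invr_eq1 => /eqP.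
Qed.

End Recurrences.

Section Multiplicity.
Variable R : realType.
Local Notation C := R[i].
Implicit Types (u v : int -> C) (s : seq int).
Let B := (4150 + 4150)%N.

(** Shifting out one root at a time gives u as the difference of two geometric sequences.
For c != 0 this is the unit equation; for c = 0 it fixes a power of the quotient of the
roots. *)
Lemma binary_distinct u (al1 al2 c : C) s : al1 != 0 -> al2 != 0 ->
  (forall n, shift al1 (shift al2 u) n = 0) -> has_order 2 u -> al1 != al2 ->
  ~ is_root_of_unity al1 \/ ~ is_root_of_unity al2 -> ~ is_root_of_unity (al1 / al2) ->
  uniq s -> (forall m, m \in s -> u m = c) -> (size s <= B)%N.
Proof.
move=> a10 a20 rec ord a12 nru nru12 us sol.
have Hp := geometric a10 rec.
have Hq : forall n, shift al1 u n = shift al1 u 0 * al2 ^ n.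
  by apply: geometric => // n; rewrite shiftC.
set p := shift al2 u 0 in Hp; set q := shift al1 u 0 in Hq.
have p0 : p != 0.
  by apply/eqP => e; apply: (order2_shift ord (be := al2)) => n; rewrite Hp e mul0r.
have q0 : q != 0.
  by apply/eqP => e; apply: (order2_shift ord (be := al1)) => n; rewrite Hq e mul0r.
have E m : m \in s -> p * al1 ^ m - q * al2 ^ m = (al1 - al2) * c.
  by move=> /sol <-; rewrite -Hp -Hq shift_sub.
have d0 : al1 - al2 != 0 by rewrite subr_eq0.
have [c0|c0] := eqVneq c 0.
  apply: (@leq_trans 1) => //; apply: (@zero_ratio _ (al1 / al2) (q / p)) => //.
    by rewrite mulf_neq0 ?invr_eq0.
  move=> m /E /eqP; rewrite c0 mulr0 subr_eq0 => /eqP e.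
  rewrite expfzMl exprz_inv -invr_expz.
  have -> : al1 ^ m = q / p * al2 ^ m by apply: (mulfI p0); rewrite e; field.
  by rewrite mulfK // expfz_neq0.
have dc0 : (al1 - al2) * c != 0 by rewrite mulf_neq0.
apply: (@unit_equation_int R C (p / ((al1 - al2) * c)) (- q / ((al1 - al2) * c)) al1 al2) => //.
- by rewrite mulf_neq0 ?invr_eq0.
- by rewrite mulf_neq0 ?oppr_eq0 ?invr_eq0.
- move=> m /E e; apply: (mulIf dc0); rewrite mul1r -[RHS]e.
  by move: dc0 {e E}; move: (_ * c) (al1 ^ m) (al2 ^ m) => D x y D0; field.
Qed.

Lemma binary_double u (al c : C) s : al != 0 ->
  (forall n, shift al (shift al u) n = 0) -> has_order 2 u ->
  uniq s -> (forall m, m \in s -> u m = c) -> (size s <= 3)%N.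
Proof.
move=> a0 rec ord us sol.
have Hp := geometric a0 rec; set p := shift al u 0 in Hp.
have p0 : p != 0.
  by apply/eqP => e; apply: (order2_shift ord (be := al)) => n; rewrite Hp e mul0r.
apply: (@linear_exponential R (u 0) (p / al) c al) => //; first by rewrite mulf_neq0 ?invr_eq0.
by move=> m /sol <-; rewrite [RHS](linear_geometric a0 Hp).
Qed.

(** Removing two of the three roots isolates each geometric component; v is their
combination by Lagrange interpolation. *)
Lemma ternary_distinct v (al1 al2 al3 : C) s : al1 != 0 -> al2 != 0 -> al3 != 0 ->
  (forall n, shift al1 (shift al2 (shift al3 v)) n = 0) -> has_order 3 v ->
  al1 != al2 -> al1 != al3 -> al2 != al3 ->
  ~ is_root_of_unity (al1 / al3) \/ ~ is_root_of_unity (al2 / al3) ->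
  uniq s -> (forall m, m \in s -> v m = 0) -> (size s <= B)%N.
Proof.
move=> a10 a20 a30 rec ord d12 d13 d23 nru us sol.
have H1 := geometric a10 rec; set c1 := shift al2 (shift al3 v) 0 in H1.
have H2 : forall n, shift al1 (shift al3 v) n = shift al1 (shift al3 v) 0 * al2 ^ n.
  by apply: geometric => // n; rewrite shiftC.
set c2 := shift al1 (shift al3 v) 0 in H2.
have H3 : forall n, shift al1 (shift al2 v) n = shift al1 (shift al2 v) 0 * al3 ^ n.
  apply: geometric => // n; rewrite shiftC -(rec n); apply: eq_shift => k.
  exact: shiftC.
set c3 := shift al1 (shift al2 v) 0 in H3.
have c10 : c1 != 0.
  by apply/eqP => e; apply: (order3_shift ord (be := al2) (ga := al3)) => n; rewrite H1 e mul0r.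
have c20 : c2 != 0.
  by apply/eqP => e; apply: (order3_shift ord (be := al1) (ga := al3)) => n; rewrite H2 e mul0r.
have c30 : c3 != 0.
  by apply/eqP => e; apply: (order3_shift ord (be := al1) (ga := al2)) => n; rewrite H3 e mul0r.
have e12 : al1 - al2 != 0 by rewrite subr_eq0.
have e13 : al1 - al3 != 0 by rewrite subr_eq0.
have e23 : al2 - al3 != 0 by rewrite subr_eq0.
have E m : m \in s ->
    (al2 - al3) * c1 * al1 ^ m - (al1 - al3) * c2 * al2 ^ m + (al1 - al2) * c3 * al3 ^ m = 0.
  move=> /sol vm; rewrite -!mulrA -H1 -H2 -H3.
  transitivity ((al1 - al2) * (al1 - al3) * (al2 - al3) * v m); last by rewrite vm mulr0.
  by rewrite /shift; ring.
have z0 : (al1 - al2) * c3 != 0 by rewrite mulf_neq0.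
apply: (@unit_equation_int R C (- ((al2 - al3) * c1) / ((al1 - al2) * c3))
   ((al1 - al3) * c2 / ((al1 - al2) * c3)) (al1 / al3) (al2 / al3)) => //.
- by rewrite mulf_neq0 ?oppr_eq0 ?invr_eq0 // mulf_neq0.
- by rewrite mulf_neq0 ?invr_eq0 // mulf_neq0.
- by rewrite mulf_neq0 ?invr_eq0.
- by rewrite mulf_neq0 ?invr_eq0.
move=> m /E /eqP; rewrite addr_eq0 => /eqP e.
have a3m : al3 ^ m != 0 by rewrite expfz_neq0.
rewrite !expfzMl !exprz_inv -!invr_expz.
apply: (mulIf z0); apply: (mulIf a3m); rewrite mul1r -[RHS]opprK -e.
move: z0 a3m {e E}; move: ((al1 - al2) * c3) ((al2 - al3) * c1) ((al1 - al3) * c2) => D X Y.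
by move: (al1 ^ m) (al2 ^ m) (al3 ^ m) => x y z D0 z0; field; rewrite z0.
Qed.

(** Eliminating between shift ga v, which is linear times al ^ n, and the twofold shift by
al, which is geometric of ratio ga, expresses (ga - al) ^ 2 * v. *)
Lemma ternary_double v (al ga : C) s : al != 0 -> ga != 0 -> al != ga ->
  (forall n, shift al (shift al (shift ga v)) n = 0) -> has_order 3 v ->
  uniq s -> (forall m, m \in s -> v m = 0) -> (size s <= 3)%N.
Proof.
move=> a0 g0 ag rec ord us sol.
have ga0 : ga - al != 0 by rewrite subr_eq0 eq_sym.
have Hd := geometric a0 rec; set d := shift al (shift ga v) 0 in Hd.
have d0 : d != 0.
  by apply/eqP => e; apply: (order3_shift ord (be := al) (ga := ga)) => n; rewrite Hd e mul0r.
have Hs := linear_geometric a0 Hd; set s0 := shift ga v 0 in Hs.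
have Hc : forall n, shift al (shift al v) n = shift al (shift al v) 0 * ga ^ n.
  apply: geometric => // n; rewrite shiftC -(rec n); apply: eq_shift => k.
  exact: shiftC.
set c := shift al (shift al v) 0 in Hc.
apply: (@linear_exponential R (d + (ga - al) * s0) ((ga - al) * (d / al)) c (al / ga)) => //.
- by rewrite !mulf_neq0 ?invr_eq0.
- by rewrite mulf_neq0 ?invr_eq0.
move=> m /sol vm; have gm : ga ^ m != 0 by rewrite expfz_neq0.
rewrite expfzMl exprz_inv -invr_expz; apply: (mulIf gm); rewrite -Hc mulrA divfK //.
transitivity (d * al ^ m + (ga - al) * ((s0 + d / al * m%:~R) * al ^ m)); first by ring.
rewrite -Hs -Hd.
transitivity (shift al (shift al v) m - (ga - al) ^+ 2 * v m); last by rewrite vm mulr0 subr0.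
by rewrite /shift; ring.
Qed.

Lemma ternary_triple v (al : C) s : al != 0 ->
  (forall n, shift al (shift al (shift al v)) n = 0) -> (exists n, v n != 0) ->
  uniq s -> (forall m, m \in s -> v m = 0) -> (size s <= 3)%N.
Proof.
move=> a0 rec [n0 vn0] us sol.
have Hd := geometric a0 rec; set d := shift al (shift al v) 0 in Hd.
have Hs := linear_geometric a0 Hd; set y0 := shift al v 0 in Hs.
have Hv := quadratic_geometric a0 Hs.
pose P : {poly C} := Poly [:: v 0; y0 / al - d / al / al / 2; d / al / al / 2].
have PE n : P.[n%:~R] * al ^ n = v n.
  by rewrite Hv horner_Poly /=; congr (_ * _); ring.
have Pn : P != 0 by apply: contra_neq vn0 => e; rewrite -PE e horner0 mul0r.
have : (size [seq (m%:~R : C) | m <- s] < size P)%N.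
  apply: max_poly_roots => //.
    apply/allP => _ /mapP [m ms ->]; rewrite /root -(mulIr_eq0 _ (mulIf (expfz_neq0 m a0))).
    by rewrite PE sol.
  by rewrite map_inj_uniq // => x y; apply: intr_inj.
by rewrite size_map => /ltnW/leq_trans; apply; apply: size_Poly.
Qed.

Lemma ternary_repeated v (al ga : C) s : al != 0 -> ga != 0 ->
  (forall n, shift al (shift al (shift ga v)) n = 0) -> has_order 3 v -> (exists n, v n != 0) ->
  uniq s -> (forall m, m \in s -> v m = 0) -> (size s <= B)%N.
Proof.
move=> a0 g0 rec ord vn us sol; apply: (@leq_trans 3) => //.
have [e|ne] := eqVneq al ga; last exact: (ternary_double a0 g0 ne rec).
by rewrite -e in rec; apply: (ternary_triple a0 rec).
Qed.

Lemma bound_le (x : \bar R) : (x <= B%:R%:E)%E -> (x <= (2 ^+ 57)%:E)%E.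
Proof.
move=> /le_trans; apply; rewrite lee_fin.
have h : 2 ^+ 14 <= 2 ^+ 57 :> R by rewrite ler_weXn2l // ler1n.
by apply: le_trans h; rewrite /B natrD -natrX; lra.
Qed.

End Multiplicity.

Theorem corollary1p2 (R : realType) :
  (forall (nu0 nu1 : R[i]) (u : int -> R[i]) (alpha1 alpha2 : R[i]),
      nu0 != 0 ->
      (forall n : int, u (n + 2) = nu1 * u (n + 1) + nu0 * u n) ->
      has_order 2 u ->
      'X^2 - nu1 *: 'X - nu0%:P = ('X - alpha1%:P) * ('X - alpha2%:P) ->
      ~ is_root_of_unity alpha1 \/ ~ is_root_of_unity alpha2 ->
      (alpha1 <> alpha2 -> ~ is_root_of_unity (alpha1 / alpha2)) ->
      (multiplicity u <= (2 ^+ 57)%:E)%E)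
  /\
  (forall (mu0 mu1 mu2 : R[i]) (v : int -> R[i])
      (alpha1 alpha2 alpha3 : R[i]),
      mu0 != 0 ->
      (forall m : int,
          v (m + 3) = mu2 * v (m + 2) + mu1 * v (m + 1) + mu0 * v m) ->
      has_order 3 v ->
      `|v 0| + `|v 1| + `|v 2| != 0 ->
      'X^3 - mu2 *: 'X^2 - mu1 *: 'X - mu0%:P =
        ('X - alpha1%:P) * ('X - alpha2%:P) * ('X - alpha3%:P) ->
      (uniq [:: alpha1; alpha2; alpha3] ->
       ~ is_root_of_unity (alpha1 / alpha3) \/
       ~ is_root_of_unity (alpha2 / alpha3)) ->
      (zero_multiplicity v <= (2 ^+ 57)%:E)%E).
Proof.
split.
- move=> nu0 nu1 u a1 a2 nu00 rec ord pol nru nru12.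
  have P0 := congr1 (fun p => p.[0]) pol; have P1 := congr1 (fun p => p.[1]) pol.
  rewrite !(hornerD, hornerN, hornerM, hornerZ, hornerX, hornerXn, hornerC) in P0 P1.
  have E0 : nu0 = - (a1 * a2).
    by apply: oppr_inj; transitivity (0 ^+ 2 - nu1 * 0 - nu0); [ring|rewrite P0; ring].
  have E1 : nu1 = a1 + a2.
    apply: oppr_inj; transitivity ((1 ^+ 2 - nu1 * 1 - nu0) - 1 + nu0); first by ring.
    by rewrite P1 E0; ring.
  have [a10 a20] : a1 != 0 /\ a2 != 0.
    by move: nu00; rewrite E0 oppr_eq0 mulf_eq0 negb_or => /andP.
  have srec n : shift a1 (shift a2 u) n = 0.
    rewrite /shift -[n + 1 + 1]addrA rec E0 E1; ring.
  apply: ub_ereal_sup => _ [c _ <-]; apply: bound_le; apply: counting_le => s us sol.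
  have [e|ne] := eqVneq a1 a2; last first.
    by apply: (binary_distinct a10 a20 srec ord ne nru _ us sol); apply: nru12; apply/eqP.
  rewrite e in srec; apply: (@leq_trans 3) => //.
  exact: (binary_double a20 srec ord us sol).
move=> mu0 mu1 mu2 v a1 a2 a3 mu00 rec ord vn pol nru.
have P0 := congr1 (fun p => p.[0]) pol; have P1 := congr1 (fun p => p.[1]) pol.
have P2 := congr1 (fun p => p.[-1]) pol.
rewrite !(hornerD, hornerN, hornerM, hornerZ, hornerX, hornerXn, hornerC) in P0 P1 P2.
have E0 : mu0 = a1 * a2 * a3.
  apply: oppr_inj; transitivity (0 ^+ 3 - mu2 * 0 ^+ 2 - mu1 * 0 - mu0); first by ring.
  by rewrite P0; ring.
have two0 : (2 : R[i]) != 0 by rewrite (pnatr_eq0 _ 2).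
have E2 : mu2 = a1 + a2 + a3.
  apply: (mulfI two0); apply: oppr_inj.
  transitivity ((1 ^+ 3 - mu2 * 1 ^+ 2 - mu1 * 1 - mu0) +
    ((-1) ^+ 3 - mu2 * (-1) ^+ 2 - mu1 * -1 - mu0) + 2 * mu0); first by ring.
  by rewrite P1 P2 E0; ring.
have E1 : mu1 = - (a1 * a2 + a1 * a3 + a2 * a3).
  apply: oppr_inj; transitivity ((1 ^+ 3 - mu2 * 1 ^+ 2 - mu1 * 1 - mu0) - 1 + mu2 + mu0).
    by ring.
  by rewrite P1 E2 E0; ring.
have [a10 a20 a30] : [/\ a1 != 0, a2 != 0 & a3 != 0].
  by move: mu00; rewrite E0 !mulf_eq0 !negb_or => /andP [/andP [? ?] ?].
have srec n : shift a1 (shift a2 (shift a3 v)) n = 0.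
  rewrite /shift; have -> : n + 1 + 1 + 1 = n + 3 by rewrite -!addrA.
  by rewrite rec -!addrA E0 E1 E2; ring.
have vn0 : exists n, v n != 0.
  have [v0|?] := eqVneq (v 0) 0; last by exists 0.
  have [v1|?] := eqVneq (v 1) 0; last by exists 1.
  have [v2|?] := eqVneq (v 2) 0; last by exists 2.
  by move: vn; rewrite v0 v1 v2 normr0 !addr0 eqxx.
apply: bound_le; apply: counting_le => s us sol.
have [e12|n12] := eqVneq a1 a2.
  by rewrite e12 in srec; apply: (ternary_repeated a20 a30 srec ord vn0 us sol).
have [e13|n13] := eqVneq a1 a3.
  rewrite e13 in srec; apply: (ternary_repeated a30 a20 _ ord vn0 us sol) => n.
  by rewrite -(srec n); apply: eq_shift => k; apply: shiftC.
have [e23|n23] := eqVneq a2 a3.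
  rewrite e23 in srec; apply: (ternary_repeated a30 a10 _ ord vn0 us sol) => n.
  rewrite -(srec n) [RHS]shiftC; apply: eq_shift => k; exact: shiftC.
apply: (ternary_distinct a10 a20 a30 srec ord n12 n13 n23 _ us sol).
by apply: nru; rewrite /= !inE !negb_or n12 n13 n23.
Qed.
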